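(* Let $k$ be a finite field with an even number $q$ of elements. For any $m\geq 1$, any pair $(\mathbf{n};\mathbf{r})\in\mathcal{N}_m$ and any integer $g$, $$\sum_{j=0}^{\min(|\mathbf{n}|-1,\,g+1)}(\hat b_j-q\,\hat b_{j-1})\,u_{g-j}=\begin{cases} J\,q^{g+1}(\hat b_{g+1}-\hat b_{g}) & \text{if } r_i=2 \text{ for all } i \text{ and } g\ge 0;\\ 0 & \text{if } r_i=1 \text{ for some } i \text{ and } g\ge \frac{|\mathbf{n}|-1}{2},\end{cases}$$ where $u_g=u_g^{(\mathbf{n};\mathbf{r})}$, $\hat b_j=\hat b_j^{\mathbf{n}}$ and $J=J^{\mathbf n}$.
   Context: Let $k$ be a finite field with $q$ elements, $q$ even, $k_m$ its extension of degree $m$ in an algebraic closure $\bar k$, and $F$ the Frobenius $x\mapsto x^q$ on $\mathbb{P}^1(\bar k)$. For $g\ge-1$ let $P_g$ be the set of pairs $(h,f)$ of polynomials over $k$, $h\ne0$, such that (1) $2g+1\le\max(2\deg h,\deg f)\le 2g+2$; (2) $\gcd(h,f'^2+fh'^2)=1$; (3) $t\nmid\gcd(h_\infty,f_\infty'^2+f_\infty h_\infty'^2)$, where $h_\infty:=t^{g+1}h(1/t)$ and $f_\infty:=t^{2g+2}f(1/t)$. For $(h,f)\in P_g$ let $h(\infty)$ and $f(\infty)$ be the coefficient of $x^{g+1}$ in $h$ and of $x^{2g+2}$ in $f$. Let $\tau_m:k_m^2\to\{1,0,-1\}$ send $(a,b)$ to $1$, $0$ or $-1$ if $y^2+ay+b=0$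 has two, one or no roots in $k_m$. Put $I:=(q^3-q)^{-1}(q-1)^{-1}$ and $I_g:=q^{-(g+2)}I$. $\mathcal{N}_m$ is the set of pairs $(\mathbf{n};\mathbf{r})$ with $\mathbf{n}=(n_1,\dots,n_m)\in\mathbb{Z}_{\ge1}^m$ and $\mathbf{r}=(r_1,\dots,r_m)\in\{1,2\}^m$; $|\mathbf{n}|:=\sum_i n_i$. $A(\mathbf{n})$ is the set of tuples $(\alpha_1,\dots,\alpha_m)\in\prod_{i}\mathbb{P}^1(k_{n_i})$ such that for all $1\le i,j\le m$ and $s\ge0$: $F^s(\alpha_i)=\alpha_j$ implies $n_i\mid s$ and $i=j$. Put $A'(\mathbf{n}):=A(\mathbf{n})\cap\prod_i\mathbb{A}^1(k_{n_i})$. For $g\ge-1$, $$u_g^{(\mathbf{n};\mathbf{r})}:=\sum_{\alpha\in A(\mathbf{n})}I_g\sum_{(h,f)\in P_g}\prod_{i=1}^m\tau_{n_i}\bigl(h(\alpha_i),f(\alpha_i)\bigr)^{r_i}.$$ For $j\ge0$, $b_j=b_j^{\mathbf{n}}$ is the number of monic polynomials $l$ over $k$ of degree $j$ with $l(\alpha_i)\ne0$ for all $i$, for any $\alpha\in A'(\mathbf{n})$; this does not depend on $\alpha$ and is given by $$b_j=q^j+\sum_{i=1}^j(-1)^i\sum_{\substack{1\le m_1<\dots<m_i\le m\\ n_{m_1}+\dots+n_{m_i}\le j}}q^{\,j-(n_{m_1}+\dots+n_{m_i})},$$ which is taken as the definition also if $A'(\mathbf{n})$ is empty. Put $\hat b_j=\hat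 b_j^{\mathbf n}:=\sum_{i=0}^j b_i$ (so $\hat b_{-1}=0$) and $J:=I\,(q-1)\,|A(\mathbf{n})|$. *)

(* Defs.v *)
From HB Require Import structures.
From mathcomp Require Import all_boot all_order all_algebra all_field zify.
From mathcomp Require Import finmap.
From mathcomp Require Import boolp classical_sets functions cardinality fsbigop.

Set Implicit Arguments.
Unset Strict Implicit.
Unset Printing Implicit Defensive.

Import Order.TTheory GRing.Theory Num.Theory.
Local Open Scope classical_set_scope.
Local Open Scope ring_scope.

(* The algebraic closure of k is a closed field K with a morphism iota : k -> K
   (in the theorem K is moreover assumed to be algebraic over k). *)
Section Closure.
Variables (k : finFieldType) (K : closedFieldType) (iota : {rmorphism k -> K}).

Definition frob (x : K) : K := x ^+ #|k|.

(* The extension k_n of degree n of k in K, as the fixed field of the n-th iterate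
   of frob, for n > 0; see kext_subfield, kext_base and card_kext below. *)
Definition kext (n : nat) : set K := [set x | iter n frob x = x].

(* The projective line over K is option K, None being the point at infinity. *)
Definition P1 (n : nat) : set (option K) :=
  [set p | if p is Some x then kext n x else True].

Definition frobP1 : option K -> option K := omap frob.

Definition Atuples m (n : 'I_m -> nat) : set {ffun 'I_m -> option K} :=
  [set a | (forall i, P1 (n i) (a i)) /\
           (forall (i j : 'I_m) (s : nat), iter s frobP1 (a i) = a j ->
              (n i %| s)%N /\ i = j)].

Definition tau (n : nat) (a b : K) : int :=
  match #|` fset_set [set y | kext n y /\ y ^+ 2 + a * y + b = 0]| with
  | 0 => -1
  | 1 => 0
  | _ => 1
  end.

(* The value at a point of the projective line of a polynomial of degree at
   most d, seen as a form of degree d: at infinity, the coefficient of 'X^d. *)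
Definition evalP1 (d : nat) (p : {poly k}) (a : option K) : K :=
  if a is Some x then (map_poly iota p).[x] else iota p`_d.

End Closure.

Arguments frob k {K} x.
Arguments kext k K n : clear implicits.
Arguments P1 k K n : clear implicits.
Arguments frobP1 k {K} a.
Arguments Atuples k K {m} n.
Arguments tau k {K} n a b.

Section Count.
Variable k : finFieldType.

(* 'X^d * p(1 / 'X), for p of degree at most d *)
Definition flip (d : nat) (p : {poly k}) : {poly k} :=
  \poly_(i < d.+1) p`_(d - i).

Definition disc (h f : {poly k}) : {poly k} := f^`() ^+ 2 + f * h^`() ^+ 2.

(* For g >= -1, `|g + 1| is g + 1; for g < -1 the degree condition makes Pg
   empty. Here the degree of f = 0 is taken to be 0, which does not change the
   maximum because h != 0. *)
Definition Pg (g : int) : set ({poly k} * {poly k}) :=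
  [set hf : {poly k} * {poly k} | let h := hf.1 in
    let f := hf.2 in
    let d := maxn (2 * (size h).-1) (size f).-1 in
    let hoo := flip `|g + 1| h in
    let foo := flip (2 * `|g + 1|) f in
    [/\ h != 0,
        2 * g + 1 <= d%:Z <= 2 * g + 2,
        coprimep h (disc h f) &
        ~~ ('X %| gcdp hoo (disc hoo foo))]].

Definition Iconst : rat :=
  let q : rat := #|k|%:R in (q ^+ 3 - q)^-1 * (q - 1)^-1.

Definition Ig (g : int) : rat := #|k|%:R ^ (- (g + 2)) * Iconst.

Definition ug (K : closedFieldType) (iota : {rmorphism k -> K})
    m (n r : 'I_m -> nat) (g : int) : rat :=
  let tau_prod (a : 'I_m -> option K) (h f : {poly k}) : rat :=
    \prod_(i < m)
      (tau k (n i) (evalP1 iota `|g + 1| h (a i))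
                   (evalP1 iota (2 * `|g + 1|) f (a i)))%:~R ^+ r i in
  \sum_(a \in Atuples k K n) (Ig g * \sum_(hf \in Pg g) tau_prod a hf.1 hf.2).

Definition Jconst (K : closedFieldType) m (n : 'I_m -> nat) : rat :=
  Iconst * (#|k|%:R - 1) * #|` fset_set (Atuples k K n)|%:R.

End Count.

Definition ntotal m (n : 'I_m -> nat) : nat := (\sum_i n i)%N.

(* By inclusion-exclusion, the number of monic polynomials of degree j over k
   not vanishing at any a i, for a in Atuples k K n without point at infinity;
   the formula is the definition also when there is no such a. The increasing
   sequences m_1 < ... < m_i of indices are the subsets S of 'I_m with i
   elements. *)
Definition bcoef (q : nat) m (n : 'I_m -> nat) (j : nat) : int :=
  q%:Z ^+ j + \sum_(1 <= i < j.+1) (-1) ^+ i *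
    \sum_(S : {set 'I_m} | (#|S| == i) && (\sum_(s in S) n s <= j)%N)
      q%:Z ^+ (j - \sum_(s in S) n s).

(* \hat b_j for j >= -1, with \hat b_(-1) = 0 *)
Definition bhat (q : nat) m (n : 'I_m -> nat) (j : int) : int :=
  if j is Posz j' then \sum_(0 <= i < j'.+1) bcoef q n i else 0.

(* The pair (n; r) belongs to N_m. *)
Definition inN m (n r : 'I_m -> nat) : Prop :=
  (forall i, 1 <= n i)%N /\ (forall i, r i = 1%N \/ r i = 2%N).

Section Facts.
Variables (k : finFieldType) (K : closedFieldType) (iota : {rmorphism k -> K}).

Lemma iter_frob n (x : K) : iter n (frob k) x = x ^+ (#|k| ^ n).
Proof.
elim: n => [|n IHn]; first by rewrite expn0 expr1.
by rewrite iterS IHn /frob -exprM expnSr.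
Qed.

Lemma pchar_card : exists2 p, p \in [pchar K] & exists e, #|k| = (p ^ e.+1)%N.
Proof.
have [p pr_p pcharkp] := finPcharP k.
exists p; first by rewrite (fmorph_pchar iota).
have [e ke] : exists e, #|k| = (p ^ e)%N.
  by exists (logn p #|k|); apply: card_pprimeChar pcharkp.
have := finNzRing_gt1 k; rewrite ke; case: e ke => // e ke _.
by exists e.
Qed.

Lemma kext_base n a : kext k K n (iota a).
Proof.
rewrite /kext /= iter_frob -rmorphXn; congr (iota _).
by elim: n => [|n IHn]; rewrite ?expn0 ?expr1 // expnSr exprM IHn expf_card.
Qed.

Lemma kext_subfield n : divring_closed (mem (kext k K n)).
Proof.
have [p pcharKp [e cardk]] := pchar_card.
have pr_p := pcharf_prime pcharKp.
have pn : [pchar K].-nat (#|k| ^ n)%N.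
  by rewrite cardk -expnM pnatX pnatE // pcharKp.
split; first by rewrite inE /kext /= iter_frob expr1n.
- move=> x y; rewrite !inE /kext /= !iter_frob => xE yE.
  by rewrite exprDn_pchar // exprNn_pchar // xE yE.
- move=> x y; rewrite !inE /kext /= !iter_frob => xE yE.
  by rewrite exprMn exprVn xE yE.
Qed.

Lemma kext_roots n : (0 < n)%N -> exists2 s : seq K, uniq s &
  kext k K n = [set` s] /\ size s = (#|k| ^ n)%N.
Proof.
move=> n_gt0; have [p pcharKp [e cardk]] := pchar_card.
have := finNzRing_gt1 k; rewrite -(ltn_exp2r _ _ n_gt0) exp1n => q_gt1.
have iterE x : kext k K n x <-> x ^+ (#|k| ^ n) = x by rewrite /kext /= iter_frob.
have q0 : (#|k| ^ n)%:R = 0 :> K.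
  apply/eqP; rewrite -(dvdn_pcharf pcharKp) cardk -expnM mulSn.
  by case: n n_gt0 {q_gt1 iterE} => // n _; rewrite mulnS addSn expnS dvdn_mulr.
move: (#|k| ^ n)%N q_gt1 iterE q0 => q q_gt1 kE q0.
pose P : {poly K} := 'X^q - 'X.
have szX : (size (- 'X : {poly K}) < size ('X^q : {poly K}))%N.
  by rewrite size_polyN size_polyX size_polyXn.
have szP : size P = q.+1 by rewrite size_polyDl // size_polyXn.
have lcP : lead_coef P = 1 by rewrite lead_coefDl // lead_coefXn.
have [s Ps] := closed_field_poly_normal P; rewrite lcP scale1r in Ps.
exists s.
  rewrite -separable_prod_XsubC -Ps separable_poly.unlock /P.
  rewrite derivB derivXn derivX -mulr_natr.
  by rewrite -polyC_natr q0 mulr0 sub0r -[- 1]scaleN1r coprimepZr ?oppr_eq0 ?oner_eq0 ?coprimep1.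
split.
  apply/seteqP; split=> x /=; rewrite -root_prod_XsubC -Ps /P rootE !hornerE.
    by move/kE=> ->; rewrite subrr.
  by rewrite subr_eq0 => /eqP /kE.
by apply: succn_inj; rewrite -szP Ps size_prod_XsubC.
Qed.

Lemma finite_kext n : (0 < n)%N -> finite_set (kext k K n).
Proof. by move=> /kext_roots[s _ [-> _]]; apply: finite_seq. Qed.

Lemma card_kext n : (0 < n)%N -> #|` fset_set (kext k K n)| = (#|k| ^ n)%N.
Proof.
move=> /kext_roots[s us [sE <-]].
have -> : kext k K n = [set` [fset x in s]%fset].
  by rewrite sE; apply/seteqP; split=> x /=; rewrite inE.
by rewrite set_fsetK card_fseq undup_id.
Qed.

(* The sums in ug are over finite sets; with an infinite support they would be 0
   by convention. *)
Lemma finite_Atuples m (n : 'I_m -> nat) : (forall i, 0 < n i)%N ->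
  finite_set (Atuples k K n).
Proof.
move=> n_gt0.
have /choice[s sP] : forall i, exists s : seq (option K),
    forall a, P1 k K (n i) a -> a \in s.
  move=> i; have [s _ [sE _]] := kext_roots (n_gt0 i).
  exists (None :: map Some s) => -[x|] //=; rewrite sE /= => xs.
  by rewrite inE /= map_f.
pose S := flatten [seq s i | i <- enum 'I_m].
apply: (@sub_finite_set _ _ (range (fun t : {ffun 'I_m -> seq_sub S} =>
  [ffun i => val (t i)]))); last by apply: finite_image; exact: finite_finset.
move=> a [aP _].
have aS i : a i \in S.
  apply/flattenP; exists (s i); last exact: (sP i _ (aP i)).
  by apply/mapP; exists i; rewrite ?mem_enum.
exists [ffun i => SeqSub (aS i)] => //.
by apply/ffunP => i; rewrite !ffunE.
Qed.

Lemma finite_Pg (g : int) : finite_set (@Pg k g).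
Proof.
pose d := (2 * `|g + 1|).+2.
pose S := [set p : {poly k} | (size p <= d)%N].
have finS : finite_set S.
  have -> : S = range (fun t : {ffun 'I_d -> k} => \poly_(i < d) oapp t 0 (insub i)).
    apply/seteqP; split=> p /=; last by move=> [t _ <-]; apply: size_poly.
    move=> szp; exists [ffun i : 'I_d => p`_i] => //.
    apply/polyP => i; rewrite coef_poly; case: ltnP => [lti|gei].
      by rewrite insubT /= ffunE.
    by rewrite nth_default // (leq_trans szp).
  by apply: finite_image; exact: finite_finset.
apply: (@sub_finite_set _ _ (S `*` S)); last exact: finite_setX.
move=> [h f] [/= h0 /andP[_ hf] _ _]; rewrite /S /=.
split; lia.
Qed.

End Facts.

(* Main.v *)
(* For a fixed tuple a of points put, for every g, W(g) = q^-(g+2) times the sum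
   of prod_i tau(h(a_i), f(a_i))^r_i over all pairs with h <> 0, deg h <= g + 1
   and deg f <= 2g + 2, singular or not.  For a place p of the projective line
   of degree d, the pairs of level g that are singular at p are, bijectively,
   the transforms (p h, p^2 f + p h s + s^2) of a pair (h, f) of level g - d by
   y |-> p y + s, with q^d choices of s.  The product of the tau's is multiplied
   under this transformation by the indicator e_p of p being nonzero at all the
   a_i.  Hence sieving out the pairs singular at p multiplies the generating
   series in X by 1 - e_p X^d, and the normalized sum u over the smooth pairs is
   W times the product of all the 1 - e_p X^(deg p).  The same sieve applied to
   polynomials instead of pairs shows that the product of 1 - X^(deg p) over
   all p is (1 - X)(1 - q X), so that
     u * prod_i (1 - X^(n_i)) = W * (1 - X)(1 - q X).
   Since prod_i (1 - X^(n_i)) / (1 - X) is the polynomial with coefficients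
   bhat_j - q bhat_(j-1), the left side of the theorem is W(g) - q W(g-1).
   If all r_i are 2, W(g) counts the h not vanishing at the a_i; if some r_i is
   1 and 2g + 3 >= |n|, translating f by polynomials that vanish at all a_j
   except a_i makes tau average to 0 at a_i. *)
Require Import Defs.
From HB Require Import structures.
From mathcomp Require Import all_boot all_order all_algebra all_field.
From mathcomp Require Import finmap.
From mathcomp Require Import boolp classical_sets functions cardinality fsbigop.
From mathcomp Require Import qpoly zify ring.

Set Implicit Arguments.
Unset Strict Implicit.
Unset Printing Implicit Defensive.

Import Order.TTheory GRing.Theory Num.Theory.
Local Open Scope ring_scope.

(** * Products of polynomials with power series given by their coefficients *)

Section Convolution.
Variable R : comNzRingType.
Implicit Types (E F : {poly R}) (w v : nat -> R).

(* The coefficient of X^n in the product of E and the power series of w. *)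
Definition conv E w n : R := \sum_(i < n.+1) E`_i * w (n - i)%N.

Lemma coefM_truncated E w n M :
  (n < M)%N -> (E * \poly_(i < M) w i)`_n = conv E w n.
Proof.
move=> ltnM; rewrite coefM; apply: eq_bigr => i _.
by rewrite coef_poly ifT //; lia.
Qed.

(** Only the values of [w] up to [n] matter, so the series may be truncated to a polynomial, and the
    claim becomes associativity of multiplication. *)
Lemma convM E F w n : conv (E * F) w n = conv E (conv F w) n.
Proof.
rewrite -!(@coefM_truncated _ _ _ n.+1) // -mulrA !coefM.
apply: eq_bigr => i _; congr (_ * _).
by rewrite coef_poly ifT ?coefM_truncated //; lia.
Qed.

Lemma conv1 w n : conv 1 w n = w n.
Proof.
rewrite -(@coefM_truncated _ _ _ n.+1) // mul1r coef_poly ltnSn //.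
Qed.

Lemma convD E F w n : conv (E + F) w n = conv E w n + conv F w n.
Proof. by rewrite -big_split; apply: eq_bigr => i _; rewrite coefD mulrDl. Qed.

Lemma convN E w n : conv (- E) w n = - conv E w n.
Proof. by rewrite -sumrN; apply: eq_bigr => i _; rewrite coefN mulNr. Qed.

Lemma convZ c E w n : conv (c *: E) w n = c * conv E w n.
Proof. by rewrite mulr_sumr; apply: eq_bigr => i _; rewrite coefZ mulrA. Qed.

Lemma conv_scale c E w n : conv E (fun i => c * w i) n = c * conv E w n.
Proof. by rewrite mulr_sumr; apply: eq_bigr => i _; rewrite mulrCA. Qed.

Lemma convXn d w n :
  conv 'X^d w n = if (d <= n)%N then w (n - d)%N else 0.
Proof.
rewrite -(@coefM_truncated _ _ _ n.+1) // coefXnM coef_poly ltnNge.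
by case: ifP => [/negbTE->|/negbFE->] //; rewrite ifT //; lia.
Qed.

Lemma conv_binomial c d w n :
  conv (1 - c *: 'X^d) w n = w n - c * (if (d <= n)%N then w (n - d)%N else 0).
Proof. by rewrite convD convN conv1 convZ convXn. Qed.

Lemma conv_binomial1 d w n :
  conv (1 - 'X^d) w n = w n - (if (d <= n)%N then w (n - d)%N else 0).
Proof. by rewrite -[X in 1 - X]scale1r conv_binomial mul1r. Qed.

Lemma eq_conv E w v n :
  (forall i, (i <= n)%N -> w i = v i) -> conv E w n = conv E v n.
Proof. by move=> eqwv; apply: eq_bigr => i _; rewrite eqwv ?leq_subr. Qed.

Lemma eq_convl E F w n :
  (forall i, (i <= n)%N -> E`_i = F`_i) -> conv E w n = conv F w n.
Proof. by move=> eqEF; apply: eq_bigr => i _; rewrite eqEF // -ltnS. Qed.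

Lemma conv_delta E n : conv E (fun i => (i == 0%N)%:R) n = E`_n.
Proof.
rewrite /conv big_ord_recr /= subnn mulr1 big1 ?add0r // => i _.
by rewrite subn_eq0 leqNgt ltn_ord mulr0.
Qed.

(** A constant term 1 makes [E] invertible as a power series: the equation at [n] determines [w n]
    from the earlier values. *)
Lemma conv_inj E w v N : E`_0 = 1 ->
  (forall n, (n <= N)%N -> conv E w n = conv E v n) ->
  forall n, (n <= N)%N -> w n = v n.
Proof.
move=> E0 eqE; elim/ltn_ind=> n IHn leN.
have := eqE n leN; rewrite /conv !big_ord_recl E0 !mul1r subn0.
have -> : \sum_(i < n) E`_(bump 0 i) * w (n - bump 0 i)%N =
          \sum_(i < n) E`_(bump 0 i) * v (n - bump 0 i)%N.
  apply: eq_bigr => i _; have := ltn_ord i => ltin.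
  by rewrite IHn // /bump leq0n; lia.
by move/addIr.
Qed.

Lemma conv_geom (q : R) n : conv (1 - q *: 'X) (fun i => q ^+ i) n = (n == 0%N)%:R.
Proof.
rewrite -['X]expr1 conv_binomial; case: n => [|n] /=.
  by rewrite mulr0 subr0.
by rewrite subn1 -exprS subrr.
Qed.

End Convolution.

(** * Squares, derivatives and [disc] in characteristic 2 *)

Section CharacteristicTwo.
Variable k : finFieldType.
Hypothesis q_even : ~~ odd #|k|.
Implicit Types (p h f s : {poly k}).

Lemma finField_pchar2 : 2 \in [pchar k].
Proof.
have [p pr_p pcharp] := finPcharP k.
have := card_pprimeChar pcharp; case: (even_prime pr_p) => [p2|p_odd].
  by move=> _; move: pcharp; rewrite p2.
by move=> kE; move: q_even; rewrite kE oddX p_odd orbT.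
Qed.

Lemma poly_pchar2 : 2 \in [pchar {poly k}].
Proof. by rewrite pchar_poly finField_pchar2. Qed.

Lemma polyDD p : p + p = 0.
Proof. exact: addrr_pchar2 poly_pchar2 p. Qed.

Lemma poly_sqrD p f : (p + f) ^+ 2 = p ^+ 2 + f ^+ 2.
Proof. by rewrite sqrrD mulr2n polyDD addr0. Qed.

Lemma deriv_sqr p : (p ^+ 2)^`() = 0.
Proof. by rewrite expr2 derivM mulrC polyDD. Qed.

(** Lets [ring], which does not know that 2 = 0, prove an identity once the terms that cancel in
    pairs are supplied as [s]. *)
Lemma poly_eq2 p f s : p = f + s + s -> p = f.
Proof. by rewrite -addrA polyDD addr0. Qed.

(** The substitution y |-> y + s changes [disc] only by a multiple of [h], so it preserves
    singularity at every prime dividing [h]. *)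
Lemma disc_translate h f s :
  disc h (f + h * s + s ^+ 2) = disc h f + h * (h * s^`() ^+ 2 + s * h^`() ^+ 2).
Proof.
rewrite /disc !derivD deriv_sqr addr0 derivM !poly_sqrD.
by apply: (@poly_eq2 _ _ (s ^+ 2 * h^`() ^+ 2)); ring.
Qed.

Lemma disc_scale p h f :
  disc (p * h) (p ^+ 2 * f) =
  p ^+ 4 * disc h f + h * (h * p ^+ 2 * f * p^`() ^+ 2).
Proof.
by rewrite /disc (derivM (p ^+ 2)) deriv_sqr mul0r add0r derivM !poly_sqrD; ring.
Qed.

Lemma sqr_sqrt_finField (a : k) : (a ^+ #|k|./2) ^+ 2 = a.
Proof. by rewrite -exprM muln2 even_halfK // expf_card. Qed.

(** A vanishing derivative leaves only even exponents, and every coefficient has a square root in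
    [k], namely its power [#|k|./2]. *)
Lemma deriv0_sqr p : p^`() = 0 -> exists s, p = s ^+ 2.
Proof.
move=> p'0; exists (\poly_(i < size p) p`_(i * 2) ^+ #|k|./2).
rewrite poly_def -[_ ^+ 2](pFrobenius_autE poly_pchar2) rmorph_sum /=.
apply/polyP=> j; rewrite coef_sum.
under eq_bigr => i _ do
  rewrite pFrobenius_autE exprZn sqr_sqrt_finField -exprM coefZ coefXn.
have [jE|j_odd] := boolP (~~ odd j); last first.
  rewrite big1 => [|i _]; last first.
    by rewrite (negbTE (_ : j != (i * 2)%N)) ?mulr0 //; apply: contra j_odd => /eqP->; lia.
  have := congr1 (fun s : {poly k} => s`_j.-1) p'0.
  rewrite coef_deriv coef0 prednK; last by case: j j_odd.
  move: j_odd; rewrite negbK -mulr_natr => j_odd.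
  suff -> : j%:R = 1 :> k by rewrite mulr1.
  by rewrite -(odd_double_half j) j_odd -muln2 natrD natrM (pcharf0 finField_pchar2) mulr0 addr0.
have [ltj|gej] := ltnP j./2 (size p).
  rewrite (bigD1 (Ordinal ltj)) //= big1 => [|i /eqP neq].
    by rewrite addr0 muln2 even_halfK // eqxx mulr1.
  rewrite (negbTE (_ : j != (i * 2)%N)) ?mulr0 //.
  by apply/eqP=> jE'; apply: neq; apply: val_inj; rewrite /= jE' muln2 doubleK.
rewrite nth_default; last by apply: leq_trans gej _; lia.
rewrite big1 // => i _; rewrite (negbTE (_ : j != (i * 2)%N)) ?mulr0 //.
by apply: contraTneq gej => ->; rewrite muln2 doubleK -ltnNge ltn_ord.
Qed.

Lemma sqr_irreducibleN s : ~ irreducible_poly (s ^+ 2).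
Proof.
move=> [sz_gt1 irr].
have s0 : s != 0 by apply: contraTneq sz_gt1 => ->; rewrite expr0n size_poly0.
have sz : (0 < size s)%N by rewrite size_poly_gt0.
have szE : size (s ^+ 2) = (size s + size s).-1 by rewrite expr2 size_mul.
have /irr : size s != 1%N by apply: contraTneq sz_gt1 => s1; rewrite szE s1.
rewrite expr2 dvdp_mulr // => /(_ isT) /eqp_size.
rewrite -expr2 szE => E; have s1 : size s = 1%N by move: sz E; case: (size s) => //=; lia.
by move: sz_gt1; rewrite szE s1.
Qed.

Lemma irreducible_deriv p : irreducible_poly p -> p^`() != 0.
Proof.
by move=> irr; apply/eqP => /deriv0_sqr [s ps]; apply: (@sqr_irreducibleN s); rewrite -ps.
Qed.

Lemma irreducible_dvd_sqr p s : irreducible_poly p -> p %| s ^+ 2 -> p %| s.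
Proof.
move=> irr; have [//|Np] := boolP (p %| s).
by rewrite expr2 Gauss_dvdpr ?irreducible_poly_coprime // (negbTE Np).
Qed.

Lemma irreducible_dvdM p h s :
  irreducible_poly p -> ~~ (p %| h) -> (p %| h * s) = (p %| s).
Proof. by move=> irr Np; rewrite Gauss_dvdpr ?irreducible_poly_coprime. Qed.

Lemma small_dvdp p s : (size s < size p)%N -> p %| s -> s = 0.
Proof.
by move=> lt ps; apply/eqP; apply: contraTT lt => s0; rewrite -leqNgt dvdp_leq.
Qed.

(** Squaring is additive and, [p] being irreducible, injective on the finite set of residues modulo
    [p]; hence it is surjective. *)
Lemma sqrt_mod p f : irreducible_poly p ->
  exists2 s : {poly k}, (size s <= (size p).-1)%N & p %| f + s ^+ 2.
Proof.
move=> irr; have p0 := irredp_neq0 irr; have sz : (0 < size p)%N by rewrite size_poly_gt0.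
have modP s : (size (s %% p)%R <= (size p).-1)%N by rewrite -ltnS prednK // ltn_modp.
pose phi (u : {poly_(size p).-1 k}) : {poly_(size p).-1 k} :=
  NPoly (modP ((u : {poly k}) ^+ 2)).
have inj_phi : injective phi.
  move=> u v /(congr1 (fun w : {poly_(size p).-1 k} => w : {poly k})) /= eq_uv.
  apply: val_inj; apply/eqP; rewrite -subr_eq0; apply/eqP.
  apply: (@small_dvdp p).
    rewrite -[X in (_ < X)%N]prednK // ltnS (leq_trans (size_polyD _ _)) //.
    by rewrite geq_max size_polyN !size_npoly.
  apply: irreducible_dvd_sqr => //.
  by rewrite poly_sqrD sqrrN /dvdp modpD eq_uv -modpD polyDD mod0p.
have [psi _ phiK] := injF_bij inj_phi.
exists (psi (NPoly (modP f)) : {poly k}); first exact: size_npoly.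
have := congr1 (fun w : {poly_(size p).-1 k} => w : {poly k}) (phiK (NPoly (modP f))).
by rewrite /= /dvdp modpD => ->; rewrite -modpD polyDD mod0p.
Qed.

(* Locally at p, y = s is a singular point of y^2 + hy + f = 0, so that
   substituting y + s for y makes the constant term divisible by p^2. *)
Lemma singular_dvd_sqr p h f s : irreducible_poly p ->
  p %| h -> p %| disc h f -> p %| f + s ^+ 2 -> p ^+ 2 %| f + h * s + s ^+ 2.
Proof.
move=> irr ph pd pf; set f1 := f + h * s + s ^+ 2.
have pf1 : p %| f1 by rewrite /f1 addrAC dvdp_add // dvdp_mulr.
have : p %| disc h f1 by rewrite disc_translate dvdp_add // dvdp_mulr.
rewrite /disc dvdp_addl; last by rewrite dvdp_mulr.
move/(irreducible_dvd_sqr irr).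
(* With [f1 = u * p], divisibility of the derivative by [p] means that [p] divides
   [u * p^]()[; as]p^[()] is nonzero of smaller degree, [p] divides [u]. *)
case/dvdpP: pf1 => u ->; rewrite derivM dvdp_addr; last by rewrite dvdp_mull.
rewrite mulrC irreducible_dvdM //; last first.
  apply/negP => pp'; have := irreducible_deriv irr.
  by rewrite (@small_dvdp p _ _ pp') ?eqxx // lt_size_deriv // irredp_neq0.
by move=> pu; rewrite expr2 dvdp_mul.
Qed.

End CharacteristicTwo.

(** * Degree bounds in terms of [size] *)

Section Degree.
Variable R : idomainType.
Implicit Types p f : {poly R}.

Lemma size_mul_leS p f a b :
  (size p <= a.+1)%N -> (size f <= b.+1)%N -> (size (p * f)%R <= (a + b).+1)%N.
Proof.
by move=> pa fb; apply: leq_trans (size_polyMleq _ _) _; lia.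
Qed.

Lemma size_sqr_leS p a : (size p <= a.+1)%N -> (size (p ^+ 2)%R <= (2 * a).+1)%N.
Proof. by move=> pa; rewrite mul2n -addnn expr2 size_mul_leS. Qed.

Lemma size_mul_leS_cancel p f a b :
  size p = a.+1 -> (size (p * f)%R <= (a + b).+1)%N -> (size f <= b.+1)%N.
Proof.
move=> pa; have [->|f0] := eqVneq f 0; first by rewrite size_poly0.
have p0 : p != 0 by rewrite -size_poly_gt0 pa.
by rewrite size_mul // pa; lia.
Qed.

Lemma size_add_leq p f n :
  (size p <= n)%N -> (size f <= n)%N -> (size (p + f)%R <= n)%N.
Proof. by move=> pn fn; rewrite (leq_trans (size_polyD _ _)) // geq_max pn. Qed.

Lemma size_sqrS p a : size p = a.+1 -> size (p ^+ 2) = (2 * a).+1.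
Proof.
by move=> pa; rewrite expr2 size_mul -?size_poly_gt0 ?pa //; lia.
Qed.

End Degree.

(** * Pairs singular at a place *)

Section SingularPairs.
Local Open Scope classical_set_scope.
Variable k : finFieldType.
Hypothesis q_even : ~~ odd #|k|.
Implicit Types (p h f s : {poly k}) (S : seq {poly k}).

Definition prime_poly p := irreducible_poly p /\ p \is monic.

Definition singular_at p h f := (p %| h) && (p %| disc h f).

(* Here and below G stands for g + 1. *)
Definition regular_pairs (G : nat) S : set ({poly k} * {poly k}) :=
  [set hf : {poly k} * {poly k} |
    [/\ hf.1 != 0, (size hf.1 <= G.+1)%N, (size hf.2 <= (2 * G).+1)%N &
    {in S, forall p, ~~ singular_at p hf.1 hf.2}]].

(* y |-> p y + s transforms y^2 + hy + f = 0 into an equation of this form. *)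
Definition transform p (shf : {poly k} * ({poly k} * {poly k})) :=
  (p * shf.2.1, p ^+ 2 * shf.2.2 + p * shf.2.1 * shf.1 + shf.1 ^+ 2).

Lemma disc_transform p h f s : exists r,
  disc (p * h) (p ^+ 2 * f + p * h * s + s ^+ 2) = p ^+ 4 * disc h f + h * r.
Proof.
rewrite disc_translate // disc_scale //.
by exists (h * p ^+ 2 * f * p^`() ^+ 2 +
  p * (p * h * s^`() ^+ 2 + s * (p * h)^`() ^+ 2)); ring.
Qed.

(** Where [p] is invertible, y |-> p y + s is an isomorphism: modulo [h] it multiplies [disc] by
    [p ^+ 4]. *)
Lemma singular_transform p p1 h f s : irreducible_poly p1 -> ~~ (p1 %| p) ->
  singular_at p1 (p * h) (p ^+ 2 * f + p * h * s + s ^+ 2) = singular_at p1 h f.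
Proof.
move=> irr Np; rewrite /singular_at irreducible_dvdM //.
have [p1h|//] := boolP (p1 %| h).
have [r ->] := disc_transform p h f s.
rewrite dvdp_addl; last exact: dvdp_mulr.
by rewrite Gauss_dvdpr // coprimep_expr // irreducible_poly_coprime.
Qed.

Lemma prime_polyNdvd p p1 : prime_poly p -> prime_poly p1 -> p1 != p -> ~~ (p1 %| p).
Proof.
move=> [irr mon] [irr1 mon1]; apply: contra => /(irr.2 _ (_ : size p1 != 1%N)).
have := irr1.1; case: eqP => [->//|_ _] /(_ isT); by rewrite eqp_monic.
Qed.

Lemma size_prime_poly p : prime_poly p -> size p = (size p).-1.+1.
Proof. by case=> -[+ _] _; case: (size p). Qed.

Lemma transform_inj p shf1 shf2 :
  p != 0 -> shf1.1 = shf2.1 -> transform p shf1 = transform p shf2 -> shf1 = shf2.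
Proof.
case: shf1 shf2 => [s1 [h1 f1]] [s2 [h2 f2]] /= p0 <- [].
move=> /(mulfI p0) -> /addIr/addIr /(mulfI (_ : p ^+ 2 != 0)) -> //.
by rewrite expf_neq0.
Qed.

(** Here [d] only bounds the degree of [p], so that the place at infinity is covered by [p = 1] and
    [d = 1]. *)
Lemma transform_regular p s h f d G S :
  (size p <= d.+1)%N -> (size s <= (d + G).+1)%N -> p != 0 ->
  {in S, forall p1, irreducible_poly p1 /\ ~~ (p1 %| p)} ->
  regular_pairs G S (h, f) -> regular_pairs (d + G) S (transform p (s, (h, f))).
Proof.
move=> szp szs p0 Sp [/= h0 szh szf reg]; split => /=.
- by rewrite mulf_neq0.
- exact: size_mul_leS.
- apply: size_add_leq; last exact: size_sqr_leS.
  apply: size_add_leq; first by rewrite mulnDr size_mul_leS ?size_sqr_leS.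
  by rewrite mul2n -addnn size_mul_leS ?size_mul_leS.
- by move=> p1 p1S; have [irr Np] := Sp _ p1S; rewrite singular_transform ?reg.
Qed.

(** The core of the sieve: [s] is the square root of [f] modulo [p], unique in degree less than that
    of [p], and once it is known the pair of lower level is found by division. *)
Lemma transform_bij p G S : prime_poly p -> p \notin S ->
  {in S, forall p1, prime_poly p1} ->
  set_bij ([set s : {poly k} | (size s <= (size p).-1)%N] `*` regular_pairs G S)
    (regular_pairs ((size p).-1 + G) S `&` [set hf : {poly k} * {poly k} | singular_at p hf.1 hf.2])
    (transform p).
Proof.
move=> pp pS Sp; have szp := size_prime_poly pp; have [irr mon] := pp.
have p0 := irredp_neq0 irr.
have Sp' : {in S, forall p1, irreducible_poly p1 /\ ~~ (p1 %| p)}.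
  move=> p1 p1S; have pp1 := Sp _ p1S; split; first exact: pp1.1.
  by apply: prime_polyNdvd => //; apply: contraNneq pS => <-.
split.
- move=> [s [h f]] [/= szs reg]; split.
    by apply: transform_regular => //; [rewrite -szp | apply: leq_trans szs _; lia].
  rewrite /= /singular_at dvdp_mulr //=.
  rewrite disc_translate // disc_scale //.
  apply: dvdp_add; last by rewrite -mulrA dvdp_mulr.
  apply: dvdp_add; first by rewrite exprS -mulrA dvdp_mulr.
  by apply/dvdp_mull/dvdp_mulr/dvdp_mulr/dvdp_mull; rewrite expr2 dvdp_mulr.
- move=> [s1 [h1 f1]] [s2 [h2 f2]] /set_mem [/= szs1 _] /set_mem [/= szs2 _] eqt.
  (* The equal second components are [s1 ^+ 2] and [s2 ^+ 2] modulo [p], so [p] divides the square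
     of [s1 - s2], hence [s1 - s2], which is too small to be nonzero. *)
  apply: (transform_inj p0 _ eqt) => /=; case: eqt => _ eqf.
  apply/eqP; rewrite -subr_eq0; apply/eqP; apply: (@small_dvdp _ p).
    by rewrite szp ltnS size_add_leq ?size_polyN.
  apply: irreducible_dvd_sqr => //.
  rewrite poly_sqrD // sqrrN.
  set a1 := (X in X + s1 ^+ 2) in eqf; set a2 := (X in _ = X + s2 ^+ 2) in eqf.
  have -> : s1 ^+ 2 = a2 + s2 ^+ 2 - a1 by rewrite -eqf addrAC subrr add0r.
  rewrite addrAC -(addrA a2) polyDD // addr0.
  rewrite /a1 /a2 expr2 -!mulrA.
  by rewrite !(dvdp_sub, dvdp_add, dvdp_mulr) //.
- move=> [h f] [[/= h0 szh szf reg] sing].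
  have [/dvdpP[h0' hE] pdisc] := andP sing; rewrite mulrC in hE.
  have [s szs ps] := sqrt_mod q_even f irr.
  have ph : p %| h by rewrite hE dvdp_mulr.
  have /dvdpP[f0] := singular_dvd_sqr q_even irr ph pdisc ps; rewrite (mulrC f0) => f0E.
  (* Translation by [s] is an involution in characteristic 2. *)
  have fE : f = p ^+ 2 * f0 + h * s + s ^+ 2.
    by rewrite -f0E; apply/esym/(@poly_eq2 _ q_even _ _ (h * s + s ^+ 2)); ring.
  have h00 : h0' != 0 by apply: contraNneq h0 => h0'0; rewrite hE h0'0 mulr0.
  exists (s, (h0', f0)); last by rewrite /transform /= -hE -fE.
  split => //=; split => //=.
  - by apply: (size_mul_leS_cancel szp); rewrite -hE.
  - apply: (size_mul_leS_cancel (size_sqrS szp)); rewrite -mulnDr -f0E.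
    have szs' : (size s <= ((size p).-1 + G).+1)%N by apply: leq_trans szs _; lia.
    by rewrite !size_add_leq ?size_sqr_leS // mul2n -addnn size_mul_leS.
  - move=> p1 p1S; have [irr1 Np] := Sp' _ p1S.
    by rewrite -(singular_transform (p := p) _ f0 s irr1 Np) -hE -fE; apply: reg.
Qed.

End SingularPairs.

(** * Prime polynomials, and the set [Pg] as a set of regular pairs *)

Section PrimesAndInfinity.
Local Open Scope classical_set_scope.
Variable k : finFieldType.
Implicit Types (p h f s : {poly k}) (S : seq {poly k}).

Lemma prime_factor f : (1 < size f)%N -> exists2 p, prime_poly p & p %| f.
Proof.
have [n] := ubnP (size f); elim: n => // n IHn in f *; rewrite ltnS => lefn f_gt1.
have f0 : f != 0 by rewrite -size_poly_gt0 ltnW.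
have [irr|Nirr] := pselect (irreducible_poly f).
  have l0 : (lead_coef f)^-1 != 0 by rewrite invr_eq0 lead_coef_eq0.
  exists ((lead_coef f)^-1 *: f); last by rewrite dvdpZl.
  split; last by rewrite monicE lead_coefZ mulVf // lead_coef_eq0.
  split=> [|q q1]; first by rewrite size_scale.
  by rewrite dvdpZr // => /(irr.2 _ q1) qf; rewrite (eqp_trans qf) // eqp_sym eqp_scale.
have [q [q1 qf Nqf]] : exists q : {poly k}, [/\ size q != 1%N, q %| f & ~~ (q %= f)].
  apply: contrapT => Nq; apply: Nirr; split=> // q q1 qf.
  by apply: contraPT Nq => Nqf; apply; exists q.
have q0 : q != 0 by apply: contraNneq f0 => q0; rewrite q0 dvd0p in qf.
have ltq : (size q < size f)%N by rewrite ltn_neqAle dvdp_leq // dvdp_size_eqp // Nqf.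
have sq : (0 < size q)%N by rewrite size_poly_gt0.
have [||p pp pq] := IHn q; [exact: leq_trans ltq lefn | by case: (size q) q1 sq => [|[]] |].
by exists p => //; apply: dvdp_trans qf.
Qed.

Definition primes_upto (N : nat) : seq {poly k} :=
  [seq val p | p : {poly_N.+1 k} <-
    [seq p : {poly_N.+1 k} <- enum {: {poly_N.+1 k}} |
      irreducibleb (val p) && (val p \is monic)]].

Lemma primes_upto_uniq N : uniq (primes_upto N).
Proof. by rewrite (map_inj_uniq val_inj) filter_uniq ?enum_uniq. Qed.

Lemma primes_uptoP N p :
  p \in primes_upto N <-> prime_poly p /\ (size p <= N.+1)%N.
Proof.
split=> [/mapP[u]|[[irr mon] szp]].
  rewrite mem_filter => /andP[/andP[/irreducibleP irr mon] _] ->.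
  by split; [split | exact: size_npoly].
apply/mapP; exists (NPoly szp : {poly_N.+1 k}) => //.
by rewrite mem_filter mem_enum /= mon !andbT; apply/irreducibleP.
Qed.

Definition singular_oo G h f :=
  'X %| gcdp (flip G h) (disc (flip G h) (flip (2 * G) f)).

Lemma dvdpX f : ('X %| f) = (f`_0 == 0).
Proof. by rewrite -['X]subr0 -polyC0 dvdp_XsubCl rootE horner_coef0. Qed.

Lemma coef0_disc h f : (disc h f)`_0 = f`_1 ^+ 2 + f`_0 * h`_1 ^+ 2.
Proof. by rewrite -!horner_coef0 /disc !hornerE !horner_coef0 !coef_deriv !mulr1n. Qed.

(** Divisibility by ['X] only involves the values at 0 of the reversed polynomials and of their
    derivatives, which are the two top coefficients of [h] and [f]. *)
Lemma singular_ooS G h f : singular_oo G.+1 h f =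
  (h`_G.+1 == 0) && (f`_(2 * G).+1 ^+ 2 + f`_(2 * G).+2 * h`_G ^+ 2 == 0).
Proof.
rewrite /singular_oo (mulnS 2) add2n; move: (2 * G)%N => G2.
by rewrite dvdp_gcd !dvdpX coef0_disc !coef_poly /= !subn0 !subn1.
Qed.

Lemma singular_oo0 h f : h != 0 -> (size h <= 1)%N -> singular_oo 0 h f = false.
Proof.
move=> h0 szh; rewrite /singular_oo dvdp_gcd dvdpX coef_poly /= subnn.
by move: h0; rewrite (size1_polyC szh) coefC eqxx polyC_eq0 => /negbTE->.
Qed.

Lemma size_leS f n : (size f <= n.+1)%N -> (size f <= n)%N = (f`_n == 0).
Proof.
move=> szf; apply/idP/eqP => [/leq_sizeP->//|f0].
apply/leq_sizeP=> j; rewrite leq_eqVlt => /orP[/eqP<-//|ltj].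
by rewrite nth_default // (leq_trans szf).
Qed.

(** A nontrivial common divisor of [h] and [disc h f] has a prime factor, of degree at most [G]
    since it divides [h]. The lower bound on the degrees follows from regularity at infinity. *)
Lemma Pg_regular (g : int) G N : g + 1 = G%:Z -> (G <= N)%N ->
  @Pg k g = regular_pairs G (primes_upto N) `&`
    [set hf : {poly k} * {poly k} | ~~ singular_oo G hf.1 hf.2].
Proof.
move=> gE leGN; apply/seteqP; split=> -[h f] /=.
  rewrite /Pg /= gE absz_nat => -[h0 szhf cop reg]; split=> //.
  have szh := size_poly_gt0 h; rewrite h0 in szh.
  split=> //=; [lia | lia |].
  move=> p /primes_uptoP[[irr _] _]; apply/negP => /andP[ph pd].
  have /coprimepP/(_ p ph pd) := cop; rewrite -size_poly_eq1 => /eqP p1.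
  by move: irr.1; rewrite p1.
move=> [[/= h0 szh szf reg] regoo]; rewrite /Pg /= gE absz_nat; split=> //.
- suff /andP[lb ub] : (2 * G <= (maxn (2 * (size h).-1) (size f).-1).+1 <= (2 * G).+1)%N.
    by move: (maxn _ _) lb ub => d lb ub; lia.
  apply/andP; split; last by have : forall a b, (a <= G.+1)%N -> (b <= (2 * G).+1)%N ->
    (maxn (2 * a.-1) b.-1 < (2 * G).+1)%N by [lia|]; apply.
  case: G leGN {gE} szh szf regoo => // G _ szh szf; rewrite singular_ooS.
  (* If the degrees were smaller, the top coefficient of [h] and the two top coefficients of [f]
     would vanish, and the pair would be singular at infinity. *)
  apply: contraNT; rewrite -ltnNge => lt.
  have : forall a b, (maxn (2 * a.-1) b.-1 < (2 * G).+1)%N ->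
      (a <= G.+1)%N && (b <= (2 * G).+1)%N.
    by move=> a b; lia.
  case/(_ (size h) (size f) _)/andP => [|szh' szf']; first by move: (maxn _ _) lt => d; lia.
  rewrite (nth_default 0 szh') (nth_default 0 szf') (nth_default 0 (leqW szf')).
  by rewrite expr0n mul0r addr0 eqxx.
- apply/negPn/negP => Ncop.
  have [|p pp] := @prime_factor (gcdp h (disc h f)).
    have : (0 < size (gcdp h (disc h f)))%N by rewrite size_poly_gt0 gcdp_eq0 negb_and h0.
    by move: Ncop; rewrite /coprimep; case: (size _) => [|[|]].
  rewrite dvdp_gcd => /andP[ph pd]; have := reg p; rewrite /singular_at ph pd /=.
  move=> H; suff /H: p \in primes_upto N by [].
  apply/primes_uptoP; split=> //; rewrite (leq_trans (dvdp_leq h0 ph)) //.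
  by rewrite (leq_trans szh).
Qed.

End PrimesAndInfinity.

(** * Pairs singular at infinity *)

Section Infinity.
Local Open Scope classical_set_scope.
Variable k : finFieldType.
Hypothesis q_even : ~~ odd #|k|.
Implicit Types (p h f s : {poly k}) (S : seq {poly k}).

Lemma coef_translate_Xn G (c : k) h f i :
  (f + h * (c *: 'X^(G.+1)) + (c *: 'X^(G.+1)) ^+ 2)`_i =
  f`_i + c * (if (i < G.+1)%N then 0 else h`_(i - G.+1)) +
  c ^+ 2 * (i == 2 * G.+1)%N%:R.
Proof.
by rewrite !coefD -scalerAr coefZ coefMXn exprZn -exprM mulnC coefZ coefXn.
Qed.

Lemma sqr_inj_char2 (a b : k) : a ^+ 2 = b ^+ 2 -> a = b.
Proof.
move=> ab; rewrite -[a](sqr_sqrt_finField q_even) -[b](sqr_sqrt_finField q_even).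
by rewrite -!exprM mulnC !exprM ab.
Qed.

(** The analogue of [transform_bij] at infinity: as a form of degree 1 its equation is the
    polynomial [1], and the residues of the possible [s] are represented by the monomials of degree
    [G.+1]. *)
Lemma transform_oo_bij G S : {in S, forall p, prime_poly p} ->
  set_bij (range (fun c : k => c *: 'X^(G.+1)) `*` regular_pairs G S)
    (regular_pairs G.+1 S `&`
      [set hf : {poly k} * {poly k} | singular_oo G.+1 hf.1 hf.2])
    (transform 1).
Proof.
move=> Sp.
have Sp' : {in S, forall p, irreducible_poly p /\ ~~ (p %| 1)}.
  by move=> p /Sp[irr _]; split=> //; rewrite dvdp1 neq_ltn orbC irr.1.
have sz_s (c : k) : (size (c *: 'X^(G.+1) : {poly k})%R <= G.+2)%N.
  by rewrite (leq_trans (size_scale_leq _ _)) // size_polyXn.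
have coef1' (c : k) h f : (f + h * (c *: 'X^(G.+1)) + (c *: 'X^(G.+1)) ^+ 2)`_(2 * G).+1 =
    f`_(2 * G).+1 + c * h`_G.
  rewrite coef_translate_Xn ltnNge (_ : (G.+1 <= _)%N) /=; last by lia.
  rewrite (_ : (_.+1 == _) = false) ?mulr0 ?addr0; last by lia.
  by rewrite (_ : ((2 * G).+1 - G.+1)%N = G) //; lia.
have coef2' (c : k) h f : (f + h * (c *: 'X^(G.+1)) + (c *: 'X^(G.+1)) ^+ 2)`_(2 * G).+2 =
    f`_(2 * G).+2 + c * h`_G.+1 + c ^+ 2.
  rewrite coef_translate_Xn ltnNge (_ : (G.+1 <= _)%N) /=; last by lia.
  rewrite (_ : (_.+2 == _) = true) ?mulr1; last by lia.
  by rewrite (_ : ((2 * G).+2 - G.+1)%N = G.+1) //; lia.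
split.
- move=> [_ [h f]] [/= [c _ <-] reg]; split.
    by apply: (transform_regular q_even (d := 1)) reg; rewrite ?oner_eq0 ?size_poly1.
  have [/= _ szh szf _] := reg.
  rewrite /= singular_ooS !mul1r expr1n mul1r coef1' coef2'.
  rewrite (nth_default 0 szh) (nth_default 0 szf) (nth_default 0 (leqW szf)).
  by rewrite mulr0 !add0r exprMn (addrr_pchar2 (finField_pchar2 q_even)) !eqxx.
- move=> [s1 [h1 f1]] [s2 [h2 f2]] /set_mem[/= [c1 _ s1E] [/= _ h1s f1s _]].
  move=> /set_mem[/= [c2 _ s2E] [/= _ h2s f2s _]]; rewrite -{}s1E -{}s2E => eqt.
  apply: (transform_inj _ _ eqt); rewrite ?oner_neq0 //=; congr (_ *: _).
  apply: sqr_inj_char2; case: eqt => _; rewrite expr1n !mul1r.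
  move/(congr1 (fun s : {poly k} => s`_(2 * G).+2)); rewrite !coef2'.
  rewrite (nth_default 0 h1s) (nth_default 0 h2s).
  by rewrite (nth_default 0 (leqW f1s)) (nth_default 0 (leqW f2s)) !mulr0 !add0r.
- move=> [h f] [[/= h0 szh szf reg]]; rewrite /= singular_ooS => /andP[/eqP hG].
  rewrite addr_eq0 (oppr_pchar2 (finField_pchar2 q_even)) => /eqP fG.
  pose c := f`_(2 * G).+2 ^+ #|k|./2; pose s : {poly k} := c *: 'X^(G.+1).
  have cE : c ^+ 2 = f`_(2 * G).+2 by exact: sqr_sqrt_finField.
  have fE : f = (f + h * s + s ^+ 2) + h * s + s ^+ 2.
    by apply/esym/(@poly_eq2 _ q_even _ _ (h * s + s ^+ 2)); ring.
  exists (s, (h, f + h * s + s ^+ 2)); last by rewrite /transform expr1n !mul1r -fE.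
  split; first by exists c.
  have szh' : (size h <= G.+1)%N by rewrite size_leS // hG.
  split=> //=.
    have sz2 : (size (f + h * s + s ^+ 2)%R <= (2 * G.+1).+1)%N.
      rewrite !size_add_leq ?size_sqr_leS ?sz_s //.
      by rewrite (leq_trans (size_mul_leS szh' (sz_s c))) //; lia.
    rewrite mulnS add2n in sz2.
    rewrite size_leS ?coef1'; last first.
      rewrite size_leS // coef2' hG mulr0 addr0 cE.
      by rewrite (addrr_pchar2 (finField_pchar2 q_even)).
    apply/eqP; rewrite -[X in _ + X](oppr_pchar2 (finField_pchar2 q_even)).
    by apply/eqP; rewrite subr_eq0; apply/eqP; apply: sqr_inj_char2; rewrite exprMn cE.
  move=> p pS; have [irr Np] := Sp' _ pS.
  rewrite -(singular_transform q_even (p := 1) _ _ s irr Np) expr1n !mul1r -fE; exact: reg.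
Qed.
End Infinity.
(** * The weight of a pair at a tuple of points *)

Section Evaluation.
Local Open Scope classical_set_scope.

Lemma card_fset_set_image (T U : choiceType) (f : T -> U) (A : set T) :
  injective f -> finite_set A -> #|` fset_set (f @` A)| = #|` fset_set A|.
Proof. by move=> injf finA; rewrite fset_set_image // card_imfset. Qed.

Lemma fsum_const1 (R : nzRingType) (T : choiceType) (A : set T) :
  finite_set A -> \sum_(x \in A) (1 : R) = #|` fset_set A|%:R.
Proof. by move=> finA; rewrite fsbig_finite // big_const_seq count_predT iter_addr_0. Qed.

Variables (k : finFieldType) (K : closedFieldType) (iota : {rmorphism k -> K}).
Hypothesis q_even : ~~ odd #|k|.

Lemma closedField_pchar2 : 2 \in [pchar K].
Proof. by rewrite (fmorph_pchar iota) finField_pchar2. Qed.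

Section Kext.
Variable n : nat.
Local Notation kn := (kext k K n).

Lemma kext0 : kn 0.
Proof. by rewrite -(rmorph0 iota); apply: kext_base. Qed.

Lemma kextB x y : kn x -> kn y -> kn (x - y).
Proof.
have [_ clB _] := kext_subfield iota n.
by move=> kx ky; apply/set_mem/clB; apply/mem_set.
Qed.

Lemma kextD x y : kn x -> kn y -> kn (x + y).
Proof. by move=> kx ky; rewrite -(oppr_pchar2 closedField_pchar2 y); apply: kextB. Qed.

Lemma kextV x : kn x -> kn x^-1.
Proof.
have [cl1 _ cld] := kext_subfield iota n.
by move=> kx; apply/set_mem; rewrite -(mul1r x^-1); apply: cld => //; apply/mem_set.
Qed.

Lemma kextM x y : kn x -> kn y -> kn (x * y).
Proof.
have [_ _ cld] := kext_subfield iota n.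
by move=> kx /kextV ky; rewrite -[y]invrK; apply/set_mem/cld; apply/mem_set.
Qed.

Lemma kextX x e : kn x -> kn (x ^+ e).
Proof.
move=> kx; elim: e => [|e IHe]; last by rewrite exprS; apply: kextM.
by rewrite expr0 -(rmorph1 iota); apply: kext_base.
Qed.

Lemma kext_horner p x : kn x -> kn (map_poly iota p).[x].
Proof.
move=> kx; elim/poly_ind: p => [|p c IHp]; first by rewrite map_poly0 horner0; apply: kext0.
rewrite rmorphD rmorphM /= map_polyX map_polyC /= !hornerE.
by apply: kextD; [apply: kextM | apply: kext_base].
Qed.

Lemma kext_evalP1 d p a : P1 k K n a -> kn (evalP1 iota d p a).
Proof. by case: a => [x|] /=; [apply: kext_horner | move=> _; apply: kext_base]. Qed.

Hypothesis n_gt0 : (0 < n)%N.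

Lemma kext_sqrt b : kn b -> exists2 y, kn y & y ^+ 2 = b.
Proof.
move=> kb; exists (b ^+ (#|k| ^ n)./2); first exact: kextX.
rewrite -exprM muln2 even_halfK; first by rewrite -iter_frob.
by rewrite oddX negb_or -lt0n n_gt0.
Qed.

Definition nroots (a b : K) : nat :=
  #|` fset_set [set y | kn y /\ y ^+ 2 + a * y + b = 0]|.

Lemma finite_roots a b : finite_set [set y | kn y /\ y ^+ 2 + a * y + b = 0].
Proof. by apply: sub_finite_set (finite_kext iota n_gt0) => y []. Qed.

Lemma eq_tau a b a' b' : nroots a b = nroots a' b' -> tau k n a b = tau k n a' b'.
Proof. by rewrite /tau -/(nroots a b) => ->. Qed.

Lemma KDD (x : K) : x + x = 0.
Proof. exact: addrr_pchar2 closedField_pchar2 x. Qed.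

Lemma K_sqrD (x y : K) : (x + y) ^+ 2 = x ^+ 2 + y ^+ 2.
Proof. by rewrite sqrrD mulr2n KDD addr0. Qed.

Lemma K_addr_eq0 (x y : K) : (x + y == 0) = (x == y).
Proof. by rewrite addr_eq0 (oppr_pchar2 closedField_pchar2). Qed.

(** Adding [s] exchanges the roots of the two equations. *)
Lemma tau_translate s a b : kn s -> tau k n a (b + a * s + s ^+ 2) = tau k n a b.
Proof.
move=> ks; apply: eq_tau.
rewrite /nroots -[RHS](@card_fset_set_image _ _ (+%R s)); [|exact: addrI|exact: finite_roots].
congr (#|` fset_set _|); apply/seteqP; split=> [y [ky yE]|_ [y [ky yE] <-]] /=.
  exists (s + y); last by rewrite addrA KDD add0r.
  split; first exact: kextD.
  by rewrite K_sqrD -yE; ring.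
split; first exact: kextD.
by rewrite -[RHS](addr0 0) -{1}yE -(KDD (s ^+ 2 + a * s)) K_sqrD; ring.
Qed.

Lemma tau_scale l a b : kn l -> l != 0 -> tau k n (l * a) (l ^+ 2 * b) = tau k n a b.
Proof.
move=> kl l0; apply: eq_tau.
rewrite /nroots -[RHS](@card_fset_set_image _ _ ( *%R l)); [|exact: mulfI|exact: finite_roots].
congr (#|` fset_set _|); apply/seteqP; split=> [y [ky yE]|_ [y [ky yE] <-]] /=.
  exists (l^-1 * y); last by rewrite mulVKf.
  split; first by apply: kextM => //; apply: kextV.
  apply: (mulfI (expf_neq0 2 l0)); rewrite mulr0 -yE; field; exact: l0.
split; first exact: kextM.
by rewrite -(mulr0 (l ^+ 2)) -yE; ring.
Qed.

Lemma nroots0 b : kn b -> nroots 0 b = 1%N.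
Proof.
move=> /kext_sqrt[y ky y2]; rewrite /nroots (_ : [set _ | _] = [set y]).
  by rewrite fset_set1 cardfs1.
apply/seteqP; split=> [z [kz /eqP]|_ ->] /=.
  by rewrite mul0r addr0 -y2 -K_sqrD expf_eq0 /= K_addr_eq0 => /eqP.
by split=> //; rewrite mul0r addr0 -y2 KDD.
Qed.

Lemma tau0 b : kn b -> tau k n 0 b = 0.
Proof. by rewrite /tau -/(nroots 0 b) => /nroots0 ->. Qed.

(** If [y] is a root, the other one is [y + a], which differs from [y]. *)
Lemma nrootsP a b : kn a -> a != 0 -> nroots a b = 0%N \/ nroots a b = 2.
Proof.
move=> ka a0; rewrite /nroots; set A := [set _ | _].
have [->|] := eqVneq A set0; first by left; rewrite fset_set0.
case/set0P => y [ky yE]; right.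
rewrite (_ : A = [set` [fset y; (y + a)%R]%fset]).
  rewrite set_fsetK cardfs2 (_ : y != y + a) //.
  by rewrite -{1}[y]addr0 (inj_eq (addrI y)) eq_sym.
apply/seteqP; split=> z /=; rewrite !inE.
  move=> [kz zE]; have : (z + y) * (z + y + a) = 0.
    have -> : (z + y) * (z + y + a) = (z ^+ 2 + a * z + b) +
      (y ^+ 2 + a * y + b) - (b + b) + (z * y + z * y) by ring.
    by rewrite zE yE !KDD subrr addr0.
  by move/eqP; rewrite mulf_eq0 -addrA !K_addr_eq0.
case/orP => /eqP-> //; split; first exact: kextD.
by rewrite -yE K_sqrD -[RHS]addr0 -(KDD (a ^+ 2)); ring.
Qed.

Lemma tau_nroots a b : kn a -> a != 0 -> tau k n a b = (nroots a b)%:Z - 1.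
Proof. by move=> ka a0; rewrite /tau -/(nroots a b); case: (nrootsP b ka a0) => ->. Qed.

Lemma tau_sqr a b : kn a -> kn b -> tau k n a b ^+ 2 = (a != 0)%:R.
Proof.
move=> ka kb; have [->|a0] := eqVneq a 0; first by rewrite tau0 // expr0n.
by rewrite tau_nroots //; case: (nrootsP b ka a0) => ->.
Qed.

(** For nonzero [a], [tau] is the number of roots minus 1. Every [y] is a root for exactly one [b],
    so the numbers of roots add up to the cardinality of [kn]. *)
Lemma fsum_tau a : kn a -> \sum_(b \in kn) ((tau k n a b)%:~R : rat) = 0.
Proof.
have finkn := finite_kext iota n_gt0.
move=> ka; have [->|a0] := eqVneq a 0; first by apply: fsbig1 => b kb; rewrite tau0.
transitivity (\sum_(b \in kn) ((nroots a b)%:R - 1 : rat)).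
  by apply: eq_fsbigr => b _; rewrite tau_nroots // rmorphB.
rewrite fsbig_split //=.
have nrootsE b : (nroots a b)%:R =
    \sum_(y \in kn) (if y ^+ 2 + a * y + b == 0 then 1 else 0 : rat).
  rewrite -fsum_const1; last exact: finite_roots.
  rewrite (_ : [set _ | _] = kn `&` [set y | y ^+ 2 + a * y + b == 0]).
    rewrite fsbig_mkcondr; apply: eq_fsbigr => y _.
    by congr (if _ then _ else _); apply/idP/idP; rewrite inE.
  by apply/seteqP; split=> y [ky /eqP].
under eq_fsbigr => b _ do rewrite nrootsE.
rewrite exchange_fsbig //.
rewrite (eq_fsbigr (fun=> 1)) ?fsum_const1 //.
  rewrite [X in _ + X]fsbig_finite //= big_const_seq count_predT iter_addr_0.
  by rewrite mulNrn subrr.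
move=> y /set_mem ky; rewrite (fsbigD1 (y ^+ 2 + a * y)) //=; last first.
  by apply: kextD; [apply: kextX | apply: kextM].
rewrite KDD eqxx fsbig1 ?addr0 // => b [kb /eqP/negbTE nb].
by rewrite K_addr_eq0 eq_sym nb.
Qed.

End Kext.

Lemma evalP1_add d p f a : evalP1 iota d (p + f) a = evalP1 iota d p a + evalP1 iota d f a.
Proof. by case: a => [x|] /=; rewrite ?coefD ?rmorphD // hornerD. Qed.

Lemma coef_mul_top (p f : {poly k}) a b : (size p <= a.+1)%N -> (size f <= b.+1)%N ->
  (p * f)`_(a + b) = p`_a * f`_b :> k.
Proof.
move=> pa fb; rewrite coefM (bigD1 (inord a)) //= inordK; last by rewrite ltnS leq_addr.
rewrite addKn big1 ?addr0 // => i ia.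
have [lt|gt|ia'] := ltngtP i a; last by
  case/eqP: ia; apply: val_inj; rewrite /= inordK ?ia' // ltnS leq_addr.
  by rewrite [f`__]nth_default ?mulr0 // (leq_trans fb) //; lia.
by rewrite nth_default ?mul0r // (leq_trans pa).
Qed.

Lemma evalP1_mul a b (p f : {poly k}) x : (size p <= a.+1)%N -> (size f <= b.+1)%N ->
  evalP1 iota (a + b) (p * f) x = evalP1 iota a p x * evalP1 iota b f x.
Proof.
move=> pa fb; case: x => [x|] /=; first by rewrite rmorphM hornerM.
by rewrite coef_mul_top // rmorphM.
Qed.

Lemma evalP1_sqr a (p : {poly k}) x : (size p <= a.+1)%N ->
  evalP1 iota (2 * a) (p ^+ 2) x = evalP1 iota a p x ^+ 2.
Proof. by move=> pa; rewrite mul2n -addnn evalP1_mul. Qed.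

Section Weight.
Variables (m : nat) (n r : 'I_m -> nat).
Hypotheses (n_gt0 : forall i, (0 < n i)%N) (r_gt0 : forall i, (0 < r i)%N).
Variable a : 'I_m -> option K.
Hypothesis aP : forall i, P1 k K (n i) (a i).

Definition weight (G : nat) (hf : {poly k} * {poly k}) : rat :=
  \prod_(i < m) (tau k (n i) (evalP1 iota G hf.1 (a i))
                             (evalP1 iota (2 * G) hf.2 (a i)))%:~R ^+ r i.

(** Here [p] is read as a form of degree [d]; thus [nonvanishing 1 1] says that no [a i] is
    infinity. *)
Definition nonvanishing d p := [forall i, evalP1 iota d p (a i) != 0].

(** At each point, [tau] is invariant under translation and under scaling by a nonzero value of [p].
    If [p] vanishes at some [a i], that factor is [tau] at (0, 0), which is 0, to a positive
    power. *)
Lemma weight_transform (p s h f : {poly k}) d G :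
  (size p <= d.+1)%N -> (size s <= (d + G).+1)%N ->
  (size h <= G.+1)%N -> (size f <= (2 * G).+1)%N ->
  weight (d + G) (transform p (s, (h, f))) = (nonvanishing d p)%:R * weight G (h, f).
Proof.
move=> szp szs szh szf; rewrite /weight /transform /=.
have factorE i : tau k (n i) (evalP1 iota (d + G) (p * h) (a i))
    (evalP1 iota (2 * (d + G)) (p ^+ 2 * f + p * h * s + s ^+ 2) (a i)) =
  tau k (n i) (evalP1 iota d p (a i) * evalP1 iota G h (a i))
    (evalP1 iota d p (a i) ^+ 2 * evalP1 iota (2 * G) f (a i)).
  have phE : evalP1 iota (d + G) (p * h) (a i) =
      evalP1 iota d p (a i) * evalP1 iota G h (a i) by rewrite evalP1_mul.
  have phsE : evalP1 iota (2 * (d + G)) (p * h * s) (a i) =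
      evalP1 iota (d + G) (p * h) (a i) * evalP1 iota (d + G) s (a i).
    by rewrite [in LHS]mul2n -addnn evalP1_mul ?size_mul_leS.
  have pfE : evalP1 iota (2 * (d + G)) (p ^+ 2 * f) (a i) =
      evalP1 iota d p (a i) ^+ 2 * evalP1 iota (2 * G) f (a i).
    by rewrite mulnDr evalP1_mul ?size_sqr_leS // evalP1_sqr.
  rewrite !evalP1_add evalP1_sqr // phsE pfE phE.
  by apply: tau_translate => //; apply: kext_evalP1.
under eq_bigr => i _ do rewrite factorE.
have [/forallP nv|] := boolP (nonvanishing d p).
  by rewrite mul1r; apply: eq_bigr => i _; rewrite tau_scale //; apply: kext_evalP1.
rewrite negb_forall => /existsP[i]; rewrite negbK => /eqP p0.
rewrite mul0r (bigD1 i) //= p0 expr0n !mul0r tau0 //; last exact: kext0.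
by rewrite mulr0z expr0n eqn0Ngt r_gt0 mul0r.
Qed.

End Weight.
End Evaluation.
(** * The sieve *)

Section Recursion.
Local Open Scope classical_set_scope.
Variables (k : finFieldType) (K : closedFieldType) (iota : {rmorphism k -> K}).
Hypothesis q_even : ~~ odd #|k|.
Implicit Types (p h f s : {poly k}) (S : seq {poly k}).
Local Notation q := #|k|.

Definition poly_le n := [set s : {poly k} | (size s <= n)%N].

Lemma poly_leE n : poly_le n = [set` [fset s in map val (enum {: {poly_n k}})]%fset].
Proof.
apply/seteqP; split=> s /=; rewrite inE; last by case/mapP => u _ ->; exact: size_npoly.
by move=> szs; apply/mapP; exists (NPoly szs : {poly_n k}); rewrite ?mem_enum.
Qed.

Lemma finite_poly_le n : finite_set (poly_le n).
Proof. by rewrite poly_leE; apply: finite_fset. Qed.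

Lemma card_poly_le n : #|` fset_set (poly_le n)| = (q ^ n)%N.
Proof.
rewrite poly_leE set_fsetK card_fseq undup_id ?(map_inj_uniq val_inj) ?enum_uniq //.
by rewrite size_map -cardE card_npoly.
Qed.

Lemma card_monomials n : #|` fset_set (range (fun c : k => c *: 'X^n))| = q.
Proof.
rewrite card_fset_set_image; last exact: finite_finset.
  rewrite (_ : setT = [set` [fset c in enum k]%fset]).
    by rewrite set_fsetK card_fseq undup_id ?enum_uniq // -cardE.
  by apply/seteqP; split=> c //= _; rewrite inE /= mem_enum.
move=> c1 c2 /(congr1 (fun s : {poly k} => s`_n)).
by rewrite !coefZ !coefXn eqxx !mulr1.
Qed.

Lemma finite_regular_pairs G S : finite_set (regular_pairs G S).
Proof.
apply: (@sub_finite_set _ _ (poly_le G.+1 `*` poly_le (2 * G).+1)).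
  by move=> hf [].
by apply: finite_setX; apply: finite_poly_le.
Qed.

Section PowerSeries.
Variables (m : nat) (n r : 'I_m -> nat).
Hypotheses (n_gt0 : forall i, (0 < n i)%N) (r_gt0 : forall i, (0 < r i)%N).
Variable a : 'I_m -> option K.
Hypothesis aP : forall i, P1 k K (n i) (a i).
Local Notation weight := (weight iota n r a).
Local Notation nonvanishing := (nonvanishing iota a).

(** The exponent [G.+1] is g + 2, as in [Ig]. *)
Definition normalized (G : nat) (A : set ({poly k} * {poly k})) : rat :=
  q%:R ^- G.+1 * \sum_(hf \in A) weight G hf.

(** The [q ^ d] choices of [s] compensate exactly for the change of normalization from level [G] to
    level [d + G]. *)
Lemma normalized_transform p d G S (A : set {poly k}) Y :
  (size p <= d.+1)%N -> A `<=` poly_le (d + G).+1 -> #|` fset_set A| = (q ^ d)%N ->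
  set_bij (A `*` regular_pairs G S) Y (transform p) ->
  normalized (d + G) Y = (nonvanishing d p)%:R * normalized G (regular_pairs G S).
Proof.
move=> szp Asub cardA bijA.
have finA : finite_set A by apply: sub_finite_set Asub (finite_poly_le _).
rewrite /normalized (reindex_fsbig _ _ _ _ bijA) /=.
rewrite (eq_fsbigr (fun shf => (nonvanishing d p)%:R * weight G shf.2)); last first.
  by move=> -[s [h f]] /set_mem [/= /Asub szs [_ szh szf _]]; rewrite weight_transform.
rewrite -mulr_fsumr.
rewrite -(pair_fsbig _ (fun (_ : {poly k}) hf => weight G hf)) //; last exact: finite_regular_pairs.
rewrite mulrCA; congr (_ * _).
set w := \sum_(j \in regular_pairs G S) _.
have -> : \sum_(s \in A) w = #|` fset_set A|%:R * w.
  by rewrite -(fsum_const1 rat) // mulr_fsuml; apply: eq_fsbigr => s _; rewrite mul1r.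
rewrite cardA natrX mulrA; congr (_ * _).
have q0 : q%:R != 0 :> rat by rewrite pnatr_eq0 -lt0n ltnW // finNzRing_gt1.
by rewrite -addnS exprD invfM mulrAC mulVf ?mul1r // expf_neq0.
Qed.

Definition Wseq S G := normalized G (regular_pairs G S).

Lemma normalizedID G S (B : set ({poly k} * {poly k})) :
  Wseq S G = normalized G (regular_pairs G S `&` B) +
             normalized G (regular_pairs G S `&` ~` B).
Proof. by rewrite /Wseq /normalized -mulrDr -fsbigID //; apply: finite_regular_pairs. Qed.

(** Remove the pairs singular at [p], which come from level [G] minus the degree of [p]. If that
    degree exceeds [G], there are none, since no nonzero [h] of level [G] is divisible by [p]. *)
Lemma Wseq_cons p S : prime_poly p -> p \notin S ->
  {in S, forall p1, prime_poly p1} ->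
  Wseq (p :: S) =1
  conv (1 - (nonvanishing (size p).-1 p)%:R *: 'X^((size p).-1)) (Wseq S).
Proof.
move=> pp pS Sp G; rewrite conv_binomial.
pose B := [set hf : {poly k} * {poly k} | singular_at p hf.1 hf.2].
rewrite (normalizedID G S B).
have -> : regular_pairs G S `&` ~` B = regular_pairs G (p :: S).
  apply/seteqP; split=> -[h f] /=.
    case=> [[h0 szh szf reg]] /negP Np; split=> // p1.
    by rewrite inE => /orP[/eqP->//|]; apply: reg.
  case=> [h0 szh szf reg]; split; last by apply/negP/reg; rewrite inE eqxx.
  by split=> // p1 p1S; apply: reg; rewrite inE p1S orbT.
rewrite addrAC; case: ifP => [ledG|ltGd].
  have -> : normalized G (regular_pairs G S `&` B) =
      (nonvanishing (size p).-1 p)%:R * Wseq S (G - (size p).-1).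
    rewrite -[G in LHS](subnKC ledG) /B.
    rewrite (normalized_transform _ _ _ (transform_bij q_even _ pp pS Sp)) //.
    - by rewrite -size_prime_poly.
    - by move=> s /= szs; rewrite /poly_le /=; apply: leq_trans szs _; lia.
    - by rewrite card_poly_le.
  by rewrite subrr add0r.
rewrite mulr0 subr0 (_ : _ `&` B = set0) ?[normalized _ set0]/normalized
    ?fsbig_set0 ?mulr0 ?add0r //.
apply/seteqP; split=> -[h f] //= [[/= h0 szh _ _] /andP[/= ph _]].
by rewrite -ltnS -(size_prime_poly pp) (leq_trans (dvdp_leq h0 ph) szh) in ltGd.
Qed.

(** The same sieve at infinity, a place of degree 1. At level 0, where [h] is a nonzero constant, no
    pair is singular there. *)
Lemma Wseq_oo S : {in S, forall p1, prime_poly p1} ->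
  (fun G => normalized G (regular_pairs G S `&`
    [set hf : {poly k} * {poly k} | ~~ singular_oo G hf.1 hf.2])) =1
  conv (1 - (nonvanishing 1 1)%:R *: 'X^1) (Wseq S).
Proof.
move=> Sp G; rewrite conv_binomial.
pose B := [set hf : {poly k} * {poly k} | singular_oo G hf.1 hf.2].
rewrite (normalizedID G S B).
have -> : regular_pairs G S `&` ~` B = regular_pairs G S `&`
    [set hf : {poly k} * {poly k} | ~~ singular_oo G hf.1 hf.2].
  by congr (_ `&` _); apply/seteqP; split=> hf /= /negP.
rewrite addrAC; case: G @B => [|G] B /=.
  rewrite mulr0 subr0 (_ : _ `&` B = set0) ?[normalized _ set0]/normalized
    ?fsbig_set0 ?mulr0 ?add0r //.
  by apply/seteqP; split=> -[h f] //= [[/= h0 szh _ _]]; rewrite /B /= singular_oo0.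
rewrite subn1 /= -/(Wseq S G).
rewrite -[G.+1]/(1 + G)%N (normalized_transform (d := 1) _ _ _ (transform_oo_bij q_even G Sp)).
- by rewrite subrr add0r.
- by rewrite size_poly1.
- move=> _ [c _ <-]; rewrite /poly_le /=.
  by rewrite (leq_trans (size_scale_leq _ _)) // size_polyXn.
- by rewrite card_monomials expn1.
Qed.

Definition Efactor S : {poly rat} :=
  \prod_(p <- S) (1 - (nonvanishing (size p).-1 p)%:R *: 'X^((size p).-1)).

Lemma Wseq_prod S : uniq S -> {in S, forall p, prime_poly p} ->
  Wseq S =1 conv (Efactor S) (Wseq [::]).
Proof.
elim: S => [|p S IHS] /=; first by move=> _ _ G; rewrite /Efactor big_nil conv1.
move=> /andP[pS uS] Sp G; have Sp' : {in S, forall p, prime_poly p}.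
  by move=> p1 p1S; apply: Sp; rewrite inE p1S orbT.
rewrite Wseq_cons //; last by apply: Sp; rewrite inE eqxx.
by rewrite /Efactor big_cons convM; apply: eq_conv => i _; apply: IHS.
Qed.

End PowerSeries.
End Recursion.

(** * The Euler product of the affine line, by sieving polynomials *)

Section EulerProduct.
Local Open Scope classical_set_scope.
Variable k : finFieldType.
Implicit Types (p h f s : {poly k}) (S : seq {poly k}).
Local Notation q := #|k|.

(** The leading coefficient is arbitrary, whence the factors q - 1 in the counts below. *)
Definition coprime_polys (G : nat) S : set {poly k} :=
  [set h : {poly k} | [/\ h != 0, (size h <= G.+1)%N & {in S, forall p, ~~ (p %| h)}]].

Lemma finite_coprime_polys G S : finite_set (coprime_polys G S).
Proof. by apply: sub_finite_set (finite_poly_le k G.+1) => h []. Qed.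

Definition Hseq S (G : nat) : rat := \sum_(h \in coprime_polys G S) (1 : rat).

Lemma HseqID G S (B : set {poly k}) :
  Hseq S G = \sum_(h \in coprime_polys G S `&` B) (1 : rat) +
             \sum_(h \in coprime_polys G S `&` ~` B) (1 : rat).
Proof. by rewrite -fsbigID //; apply: finite_coprime_polys. Qed.

Lemma mul_coprime_bij p G S : prime_poly p -> p \notin S ->
  {in S, forall p1, prime_poly p1} ->
  set_bij (coprime_polys G S)
    (coprime_polys ((size p).-1 + G) S `&` [set h : {poly k} | p %| h]) ( *%R p).
Proof.
move=> pp pS Sp; have szp := size_prime_poly pp.
have p0 := irredp_neq0 pp.1.
have Sp' p1 h : p1 \in S -> (p1 %| p * h) = (p1 %| h).
  move=> p1S; apply: irreducible_dvdM; first exact: (Sp _ p1S).1.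
  by apply: prime_polyNdvd => //; [apply: Sp | apply: contraNneq pS => <-].
split.
- move=> h [h0 szh hS]; split; last by rewrite /= dvdp_mulr.
  split; first by rewrite mulf_neq0.
    by rewrite size_mul_leS // -szp.
  by move=> p1 p1S; rewrite Sp' ?hS.
- by move=> h1 h2 _ _; apply: mulfI.
- move=> h [[h0 szh hS] /= /dvdpP[h1 hE]]; rewrite mulrC in hE.
  exists h1 => //; split; first by apply: contraNneq h0 => h10; rewrite hE h10 mulr0.
    by apply: (size_mul_leS_cancel szp); rewrite -hE.
  by move=> p1 p1S; rewrite -Sp' // -hE hS.
Qed.

Lemma Hseq_cons p S : prime_poly p -> p \notin S ->
  {in S, forall p1, prime_poly p1} ->
  Hseq (p :: S) =1 conv (1 - 'X^((size p).-1)) (Hseq S).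
Proof.
move=> pp pS Sp G; rewrite conv_binomial1 (HseqID G S [set h : {poly k} | p %| h]).
have -> : coprime_polys G S `&` ~` [set h : {poly k} | p %| h] = coprime_polys G (p :: S).
  apply/seteqP; split=> h /=.
    case=> [[h0 szh hS]] /negP Np; split=> // p1.
    by rewrite inE => /orP[/eqP->//|]; apply: hS.
  case=> [h0 szh hS]; split; last by apply/negP/hS; rewrite inE eqxx.
  by split=> // p1 p1S; apply: hS; rewrite inE p1S orbT.
rewrite addrAC; case: ifP => [ledG|ltGd].
  have -> : \sum_(h \in coprime_polys G S `&` [set h : {poly k} | p %| h]) (1 : rat) =
      Hseq S (G - (size p).-1).
    by rewrite -[G in LHS](subnKC ledG) (reindex_fsbig _ _ _ _ (mul_coprime_bij _ pp pS Sp)).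
  by rewrite subrr add0r.
rewrite subr0 (_ : _ `&` [set h : {poly k} | p %| h] = set0) ?fsbig_set0 ?add0r //.
apply/seteqP; split=> h //= [[h0 szh _] ph].
by rewrite -ltnS -(size_prime_poly pp) (leq_trans (dvdp_leq h0 ph) szh) in ltGd.
Qed.

Lemma Hseq_oo S :
  (fun G => \sum_(h \in coprime_polys G S `&` [set h : {poly k} | h`_G != 0])
    (1 : rat)) =1
  conv (1 - 'X^1) (Hseq S).
Proof.
move=> G; rewrite conv_binomial1 (HseqID G S [set h : {poly k} | h`_G != 0]) /=.
suff -> : \sum_(h \in coprime_polys G S `&` ~` [set h : {poly k} | h`_G != 0]) (1 : rat) =
  (if (0 < G)%N then Hseq S (G - 1) else 0) by rewrite addrK.
case: G => [|G] /=.
  rewrite (_ : _ `&` _ = set0) ?fsbig_set0 //.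
  apply/seteqP; split=> h //= [[h0 szh _]]; apply; apply: contraNneq h0 => h00.
  by rewrite (size1_polyC szh) h00.
rewrite subn1 /=; apply: eq_fsbigl; apply/seteqP; split=> h /=.
  by case=> [[h0 szh hS]] /negP; rewrite negbK => hG; split=> //; rewrite size_leS.
case=> h0 szh hS; split; first by split=> //; apply: leqW.
by apply/negP; rewrite negbK -size_leS // leqW.
Qed.

Lemma Hseq_prod S : uniq S -> {in S, forall p, prime_poly p} ->
  Hseq S =1 conv (\prod_(p <- S) (1 - 'X^((size p).-1))) (Hseq [::]).
Proof.
elim: S => [|p S IHS] /=; first by move=> _ _ G; rewrite big_nil conv1.
move=> /andP[pS uS] Sp G; have Sp' : {in S, forall p, prime_poly p}.
  by move=> p1 p1S; apply: Sp; rewrite inE p1S orbT.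
rewrite Hseq_cons //; last by apply: Sp; rewrite inE eqxx.
by rewrite big_cons convM; apply: eq_conv => i _; apply: IHS.
Qed.

Lemma fsum_poly_le_neq0 n :
  \sum_(h \in [set h : {poly k} | h != 0 /\ (size h <= n)%N]) (1 : rat) = q%:R ^+ n - 1.
Proof.
rewrite -natrX -card_poly_le -(fsum_const1 rat (finite_poly_le k n)).
rewrite (fsbigD1 0 _ _ (finite_poly_le k n)) /=; last by rewrite /poly_le /= size_poly0.
rewrite addrAC subrr add0r; apply: eq_fsbigl; apply/seteqP; split=> h /=.
  by case=> /eqP.
by case=> ? /eqP.
Qed.

Lemma Hseq_nil G : Hseq [::] G = q%:R ^+ G.+1 - 1.
Proof.
rewrite -fsum_poly_le_neq0; apply: eq_fsbigl; apply/seteqP; split=> h /=.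
  by case.
by case.
Qed.

Lemma Hseq_primes N G : (G <= N)%N -> Hseq (primes_upto k N) G = q%:R - 1.
Proof.
move=> leGN; rewrite -[q%:R]expr1 -fsum_poly_le_neq0; apply: eq_fsbigl.
apply/seteqP; split=> h /=.
  case=> h0 szh hS; split=> //; rewrite leqNgt; apply/negP => /prime_factor[p pp ph].
  have := hS p; rewrite ph => H; suff /H : p \in primes_upto k N by [].
  apply/primes_uptoP; split=> //.
  by rewrite (leq_trans (dvdp_leq h0 ph)) // (leq_trans szh).
case=> h0 szh; split=> //; first exact: leq_trans szh _.
move=> p /primes_uptoP[[[p_gt1 _] _] _]; apply: contraTN p_gt1 => ph.
by rewrite -leqNgt (leq_trans (dvdp_leq h0 ph)).
Qed.

Lemma q_neq1 : (q%:R - 1 : rat) != 0.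
Proof. by rewrite subr_eq0 -[1]/1%:R eqr_nat neq_ltn orbC finNzRing_gt1. Qed.

Lemma conv_Hseq_nil n :
  conv (1 - 'X) (Hseq [::]) n = (q%:R - 1) * q%:R ^+ n.
Proof.
rewrite -['X]expr1 conv_binomial1 Hseq_nil; case: n => [|n] /=.
  by rewrite subr0 expr0 mulr1.
by rewrite subn1 Hseq_nil /= opprB addrA subrK mulrBl mul1r -exprS.
Qed.

(* A polynomial prime to all primes of degree at most N, and of degree at most
   N itself, is constant; this computes the Euler product of the zeta function
   of the affine line modulo X^(N+1). *)
Lemma euler_product N i : (i <= N)%N ->
  (\prod_(p <- primes_upto k N) (1 - 'X^((size p).-1)) : {poly rat})`_i =
  (1 - q%:R *: 'X)`_i.
Proof.
move=> leiN; apply: (mulfI q_neq1); set E := \prod_(p <- _) _.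
rewrite -!conv_delta -!conv_scale.
(* The series of [Hseq [::]] is (q - 1) / ((1 - X)(1 - q X)). On the other hand its product with [E]
   is (q - 1) / (1 - X) up to degree [N], and comparing the two gives [E]. *)
have geomE j : (q%:R - 1) * (j == 0%N)%:R =
    conv ((1 - q%:R *: 'X) * (1 - 'X)) (Hseq [::]) j.
  rewrite convM -(conv_geom (q%:R : rat)) -conv_scale.
  by apply: eq_conv => l _; rewrite conv_Hseq_nil.
transitivity (conv E (conv ((1 - q%:R *: 'X) * (1 - 'X)) (Hseq [::])) i).
  by apply: eq_conv.
rewrite -convM mulrC -mulrA convM; apply: eq_conv => j leji.
rewrite convM -['X]expr1 conv_binomial1.
have EH l : (l <= N)%N -> conv E (Hseq [::]) l = q%:R - 1.
  move=> lelN; rewrite -(Hseq_primes lelN) Hseq_prod ?primes_upto_uniq //.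
  by move=> p /primes_uptoP[].
rewrite EH ?(leq_trans leji) //; case: j leji => [|j] ltji /=.
  by rewrite subr0 mulr1.
by rewrite EH ?subrr ?mulr0 // subn1 /= (leq_trans (ltnW ltji)).
Qed.

End EulerProduct.
(** * The places below a tuple of points *)

Section MinimalPolynomial.
Local Open Scope classical_set_scope.
Variables (k : finFieldType) (K : closedFieldType) (iota : {rmorphism k -> K}).
Local Notation frob := (@frob k K).

Lemma frob_zmod_morphism : zmod_morphism frob.
Proof.
have [p pcharKp [e cardk]] := pchar_card iota.
have pq : [pchar K].-nat #|k|.
  by rewrite cardk pnatX pnatE ?(pcharf_prime pcharKp) // pcharKp.
by move=> x y; rewrite /Defs.frob exprDn_pchar // exprNn_pchar.
Qed.

Lemma frob_monoid_morphism : monoid_morphism frob.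
Proof. by split=> [|x y]; rewrite /Defs.frob ?expr1n // exprMn. Qed.

Lemma frob_rmorphism : exists F : {rmorphism K -> K}, forall x, F x = frob x.
Proof.
pose F : K -> K := frob.
pose F' : {rmorphism K -> K} :=
  HB.pack F (GRing.isZmodMorphism.Build K K F frob_zmod_morphism)
            (GRing.isMonoidMorphism.Build K K F frob_monoid_morphism).
by exists F'.
Qed.

Lemma frob_iota c : frob (iota c) = iota c.
Proof. by rewrite /Defs.frob -rmorphXn expf_card. Qed.

(** Over [k], X^q - X is the product of all X - c. *)
Lemma frob_fixed y : frob y = y -> exists c, iota c = y.
Proof.
move=> fy; have /(congr1 (fun p => (map_poly iota p).[y])) := finField_genPoly k.
rewrite rmorphB rmorphXn /= map_polyX !hornerE -[_ ^+ _]/(frob y) fy subrr.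
rewrite rmorph_prod horner_prod => /esym/eqP/prodf_eq0[c _].
by rewrite rmorphB /= map_polyX map_polyC !hornerE subr_eq0 => /eqP; exists c.
Qed.

Lemma root_frob (f : {poly k}) s x :
  (map_poly iota f).[x] = 0 -> (map_poly iota f).[iter s frob x] = 0.
Proof.
move=> fx; elim: s => //= s IHs.
have [F FE] := frob_rmorphism.
have -> : map_poly iota f = map_poly F (map_poly iota f).
  by apply/polyP => i; rewrite !coef_map /= FE frob_iota.
by rewrite -FE horner_map IHs rmorph0.
Qed.

(** The polynomial is the product of X - z over the Frobenius orbit of [x], which has exactly [n]
    elements; being invariant under Frobenius, it has coefficients in [k]. *)
Lemma minimal_polynomial n x : (0 < n)%N -> kext k K n x ->
  (forall s, iter s frob x = x -> (n %| s)%N) ->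
  exists p : {poly k}, [/\ prime_poly p, size p = n.+1,
    (forall f, ((map_poly iota f).[x] == 0) = (p %| f)) &
    forall y, (map_poly iota p).[y] = 0 -> exists s, iter s frob x = y].
Proof.
move=> n_gt0 kx xP.
have iterD s t : iter s frob (iter t frob x) = iter (s + t) frob x by rewrite iterD.
pose rs := mkseq (fun s => iter s frob x) n.
have rs_uniq : uniq rs.
  apply/mkseq_uniqP => s t; rewrite !inE.
  suff H u v : (u < n)%N -> (v < n)%N -> (u < v)%N ->
      iter u frob x = iter v frob x -> False.
    move=> ltsn lttn eqst; case: (ltngtP s t) => // [lt|lt].
      by case: (H s t).
    by case: (H t s).
  move=> ltu ltv ltuv equv.
  (* Applying Frobenius [n - u] more times turns a repetition into a period [n + (v - u)], which [n]
     does not divide. *)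
  have /xP : iter (n - u + v) frob x = x by rewrite -iterD -equv iterD subnK // ltnW.
  rewrite (_ : n - u + v = n + (v - u))%N; last by lia.
  by rewrite dvdn_addr // => /dvdn_leq; lia.
pose P := \prod_(z <- rs) ('X - z%:P).
have PE : P = \prod_(s < n) ('X - (iter s frob x)%:P).
  rewrite /P /rs /mkseq big_map.
  by rewrite -(big_mkord xpredT (fun s => 'X - (iter s frob x)%:P)) /index_iota subn0.
have [F FE] := frob_rmorphism.
(* Frobenius permutes the factors cyclically, sending the last one to the first. *)
have Pfix : map_poly F P = P.
  rewrite PE rmorph_prod; case: n n_gt0 kx {xP rs rs_uniq P PE} => // n _ kx.
  rewrite big_ord_recr big_ord_recl mulrC; congr (_ * _).
    by apply: eq_bigr => i _; rewrite rmorphB /= map_polyX map_polyC /= FE.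
  by rewrite rmorphB /= map_polyX map_polyC /= FE -iterS kx.
have /choice[c cE] i : exists c, iota c = P`_i.
  by apply: frob_fixed; rewrite -[in RHS]Pfix coef_map /= FE.
pose p := \poly_(i < size P) c i.
have pE : map_poly iota p = P.
  apply/polyP => i; rewrite coef_map coef_poly /=; case: ltnP => [_|gei]; first by rewrite cE.
  by rewrite rmorph0 nth_default.
have p_monic : p \is monic by rewrite -(map_monic iota) pE monic_prod_XsubC.
have szp : size p = n.+1 by rewrite -(size_map_poly iota) pE size_prod_XsubC size_mkseq.
have px0 : (map_poly iota p).[x] = 0.
  by rewrite pE; apply/rootP; rewrite root_prod_XsubC; apply/mapP; exists 0%N; rewrite ?mem_iota.
have pP f : ((map_poly iota f).[x] == 0) = (p %| f).
  apply/eqP/idP => [fx|/dvdpP[u ->]]; last by rewrite rmorphM hornerM px0 mulr0.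
  rewrite -(dvdp_map iota) pE; apply: uniq_roots_dvdp; last by rewrite uniq_rootsE.
  by apply/allP => _ /mapP[s _ ->]; apply/rootP/root_frob.
exists p; split=> //; last first.
  move=> y /eqP; rewrite pE -[_ == 0]/(root P y) root_prod_XsubC => /mapP[s _ ->].
  by exists s.
split=> //; split; first by rewrite szp ltnS.
(* For [p = v * u], [x] is a root of [v] or of [u], so [p] divides one of them. If it divides [v],
   then [u] is constant, against [u1]. *)
move=> u u1 up; have p0 := monic_neq0 p_monic.
case/dvdpP: (up) => v pvu.
have v0 : v != 0 by apply: contraNneq p0 => v0; rewrite pvu v0 mul0r.
have u0 : u != 0 by apply: contraNneq p0 => u0; rewrite pvu u0 mulr0.
have : (map_poly iota p).[x] == 0 by rewrite px0.
rewrite pvu rmorphM hornerM mulf_eq0 !pP => /orP[pv|pu]; last by rewrite -pvu /eqp up.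
have := dvdp_leq v0 pv; rewrite [in X in (X <= _)%N]pvu size_mul //.
have : (0 < size u)%N by rewrite size_poly_gt0.
move: u1; case: (size u) => [|[|su]] // _ _; rewrite addnS /=.
by move: (size v) => sv; lia.
Qed.
End MinimalPolynomial.
Section Places.
Local Open Scope classical_set_scope.
Variables (k : finFieldType) (K : closedFieldType) (iota : {rmorphism k -> K}).
Hypothesis q_even : ~~ odd #|k|.
Local Notation q := #|k|.
Variables (m : nat) (n : 'I_m -> nat).
Hypothesis n_gt0 : forall i, (0 < n i)%N.
Variable a : {ffun 'I_m -> option K}.
Hypothesis aA : Atuples k K n a.

Lemma Atuples_P1 i : P1 k K (n i) (a i).
Proof. by case: aA. Qed.

Lemma Atuples_inj i j s : iter s (frobP1 k) (a i) = a j -> i = j.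
Proof. by case: aA => _ H /H[]. Qed.

Lemma iter_frobP1 s (x : K) : iter s (frobP1 k) (Some x) = Some (iter s (frob k) x).
Proof. by elim: s => //= s ->. Qed.

(** Frobenius fixes infinity, so [n i] divides 1. *)
Lemma degree_infinity i : a i = None -> n i = 1%N.
Proof.
move=> aiN; case: aA => _ /(_ i i 1%N); rewrite /= aiN => /(_ erefl)[+ _].
by rewrite dvdn1 => /eqP.
Qed.

(* The place of the projective line over k below a i, as a form of degree n i;
   the form 1 of degree 1 is the equation of the point at infinity. *)
Lemma place_exists i : exists p : {poly k},
  [/\ (size p <= (n i).+1)%N, (forall j, (evalP1 iota (n i) p (a j) == 0) = (i == j)) &
   forall x, a i = Some x -> [/\ prime_poly p, size p = (n i).+1 &
     forall f, ((map_poly iota f).[x] == 0) = (p %| f)]].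
Proof.
case ai : (a i) => [x|]; last first.
  exists 1; rewrite size_poly1; split=> // j; rewrite (degree_infinity ai).
  case aj : (a j) => [y|] /=.
    by rewrite rmorph1 hornerC oner_eq0; apply/esym/eqP => ij; move: aj; rewrite -ij ai.
  by rewrite coef1 rmorph0 eqxx (@Atuples_inj i j 0) ?eqxx //= ai aj.
have [||p [pp szp pP roots_p]] := @minimal_polynomial k K iota (n i) x (n_gt0 i).
- by have := Atuples_P1 i; rewrite ai.
- move=> s sx; case: aA => _ /(_ i i s); rewrite ai iter_frobP1 sx => /(_ erefl).
  by case.
exists p; split=> //; first by rewrite szp.
  move=> j; case aj : (a j) => [y|] /=; last first.
    rewrite -[n i]/(n i).+1.-1 -szp -[p`__]/(lead_coef p) (monicP pp.2) rmorph1 oner_eq0.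
    by apply/esym/eqP=> ij; move: aj; rewrite -ij ai.
  apply/eqP/eqP => [/roots_p[s sE]|ij].
    by apply: (@Atuples_inj i j s); rewrite ai iter_frobP1 sE aj.
  by move: aj; rewrite -ij ai => -[<-]; apply/eqP; rewrite pP.
by move=> _ [<-].
Qed.

Definition place i : {poly k} := projT1 (cid (place_exists i)).

Lemma size_place i : (size (place i) <= (n i).+1)%N.
Proof. by rewrite /place; case: cid => /= p []. Qed.

Lemma place_eval i j : (evalP1 iota (n i) (place i) (a j) == 0) = (i == j).
Proof. by rewrite /place; case: cid => /= p []. Qed.

Lemma place_finite i x : a i = Some x -> [/\ prime_poly (place i),
  size (place i) = (n i).+1 &
  forall f, ((map_poly iota f).[x] == 0) = (place i %| f)].
Proof. by rewrite /place; case: cid => /= p [] _ _; apply. Qed.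

Lemma prime_place i : a i -> prime_poly (place i).
Proof. by case ai : (a i) => [x|] // _; have [] := place_finite ai. Qed.

Lemma size_place_finite i : a i -> size (place i) = (n i).+1.
Proof. by case ai : (a i) => [x|] // _; have [] := place_finite ai. Qed.

Lemma place_inj i j : a i -> a j -> place i = place j -> i = j.
Proof.
move=> ai aj pij; apply/eqP; rewrite -place_eval.
have nij : n i = n j by apply: succn_inj; rewrite -!size_place_finite ?pij.
by rewrite nij pij place_eval.
Qed.

Definition finite_places : seq {poly k} := [seq place i | i <- enum 'I_m & a i].

Lemma finite_placesP p : reflect (exists2 i, a i & p = place i) (p \in finite_places).
Proof.
apply: (iffP mapP) => [[i]|[i ai ->]].
  by rewrite mem_filter => /andP[ai _] ->; exists i.
by exists i => //; rewrite mem_filter ai mem_enum.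
Qed.

Lemma finite_places_uniq : uniq finite_places.
Proof.
rewrite map_inj_in_uniq ?(filter_uniq _ (enum_uniq _)) // => i j.
by rewrite !mem_filter => /andP[ai _] /andP[aj _]; apply: place_inj.
Qed.

Lemma finite_places_prime : {in finite_places, forall p, prime_poly p}.
Proof. by move=> _ /finite_placesP[i ai ->]; apply: prime_place. Qed.

Definition infinity_free := [forall i, isSome (a i)].

Lemma infinityP : reflect (exists i, a i = None) (~~ infinity_free).
Proof.
rewrite negb_forall; apply: (iffP existsP) => -[i]; first by case ai : (a i) => //; exists i.
by move=> ai; exists i; rewrite ai.
Qed.

Lemma nonvanishing_infinity : nonvanishing iota a 1 1 = infinity_free.
Proof.
apply/forallP/forallP => H i; have := H i; case: (a i) => [x|] //=.
  by rewrite coef1 rmorph0 eqxx.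
by rewrite rmorph1 hornerC oner_eq0.
Qed.

Lemma nonvanishing_poly G h : nonvanishing iota a G h =
  (infinity_free || (h`_G != 0)) && all (fun p => ~~ (p %| h)) finite_places.
Proof.
apply/forallP/andP => [H|[Hoo Hfin] i].
  split.
    rewrite -implyNb; apply/implyP => /infinityP[i ai]; have := H i.
    by rewrite ai /= fmorph_eq0.
  apply/allP => _ /finite_placesP[i ai ->]; have := H i.
  by case ai' : (a i) ai => [x|] //= _; have [_ _ ->] := place_finite ai'.
case ai : (a i) => [x|] /=.
  have [_ _ ->] := place_finite ai; apply: (allP Hfin).
  by apply/finite_placesP; exists i; rewrite ?ai.
by rewrite fmorph_eq0; case/orP: Hoo => // /forallP/(_ i); rewrite ai.
Qed.

Lemma nonvanishing_prime p : prime_poly p ->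
  nonvanishing iota a (size p).-1 p = (p \notin finite_places).
Proof.
move=> pp; rewrite nonvanishing_poly -[p`__]/(lead_coef p) (monicP pp.2) oner_eq0 orbT /=.
apply/allP/idP => [H|Np p1 p1S]; first by apply/negP => /H; rewrite dvdpp.
by apply: prime_polyNdvd => //; [apply: finite_places_prime | apply: contraNneq Np => <-].
Qed.

Definition Dpoly : {poly rat} := \prod_i (1 - 'X^(n i)).

(** At most one [a i] is infinity, and its degree is 1. *)
Lemma prod_infinity : \prod_(i | ~~ a i) (1 - 'X^(n i)) =
  if infinity_free then 1 else 1 - 'X :> {poly rat}.
Proof.
have [/forallP fin|/infinityP[i ai]] := ifPn.
  by rewrite big_pred0 // => i; rewrite fin.
rewrite (bigD1 i) /=; last by rewrite ai.
rewrite (degree_infinity ai) big1 ?mulr1 // => j /andP[].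
by case aj: (a j) => // _; rewrite (@Atuples_inj j i 0) ?eqxx // /= ai aj.
Qed.

Lemma prod_finite_places :
  \prod_(p <- finite_places) (1 - 'X^((size p).-1)) =
  \prod_(i | isSome (a i)) (1 - 'X^(n i)) :> {poly rat}.
Proof.
rewrite big_map big_filter big_enum_cond /=; apply: eq_bigr => i /= ai.
by rewrite size_place_finite.
Qed.

Lemma Dpoly_places : Dpoly =
  (if infinity_free then 1 else 1 - 'X) *
  \prod_(p <- finite_places) (1 - 'X^((size p).-1)).
Proof.
rewrite prod_finite_places -prod_infinity /Dpoly (bigID (fun i => isSome (a i))) /=.
by rewrite mulrC.
Qed.

(** The left product lacks precisely the factors at the places below [a], and [Dpoly] supplies them;
    the bound on [n i] puts the finite ones among the primes considered. *)
Lemma Efactor_Dpoly N : (forall i, n i <= N)%N ->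
  Dpoly * (1 - (nonvanishing iota a 1 1)%:R *: 'X) *
    Efactor iota a (primes_upto k N) =
  (1 - 'X) * \prod_(p <- primes_upto k N) (1 - 'X^((size p).-1)).
Proof.
move=> leN; set P := primes_upto k N.
have -> : Efactor iota a P = \prod_(p <- P | p \notin finite_places) (1 - 'X^((size p).-1)).
  rewrite big_mkcond /Efactor big_seq [RHS]big_seq; apply: eq_bigr => p /primes_uptoP[pp _].
  rewrite nonvanishing_prime //; case: ifP; first by rewrite scale1r.
  by rewrite scale0r subr0.
rewrite [in RHS](bigID (fun p => p \in finite_places)) /= mulrA; congr (_ * _).
have -> : \prod_(p <- P | p \in finite_places) (1 - 'X^((size p).-1)) =
    \prod_(p <- finite_places) (1 - 'X^((size p).-1)) :> {poly rat}.
  rewrite -big_filter; apply: perm_big; apply: uniq_perm.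
  - by rewrite filter_uniq // primes_upto_uniq.
  - exact: finite_places_uniq.
  - move=> p; rewrite mem_filter andb_idr // => /finite_placesP[i ai ->].
    apply/primes_uptoP; split; first exact: prime_place.
    by rewrite size_place_finite // ltnS.
rewrite Dpoly_places nonvanishing_infinity mulrAC; congr (_ * _).
by case: infinity_free; rewrite ?scale1r ?mul1r // scale0r subr0 mulr1.
Qed.

(** The sieve for polynomials, applied to the places below [a] only. *)
Lemma count_nonvanishing G :
  \sum_(h \in [set h : {poly k} | [/\ h != 0, (size h <= G.+1)%N & nonvanishing iota a G h]])
    (1 : rat) = conv Dpoly (@Hseq k [::]) G.
Proof.
have setE : [set h : {poly k} | [/\ h != 0, (size h <= G.+1)%N & nonvanishing iota a G h]] =
    coprime_polys G finite_places `&`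
      [set h : {poly k} | infinity_free || (h`_G != 0)].
  apply/seteqP; split=> h /=.
    by rewrite nonvanishing_poly => -[h0 szh /andP[Hoo /allP Hfin]]; split.
  by case=> -[h0 szh Hfin] Hoo; split=> //; rewrite nonvanishing_poly Hoo; apply/allP.
rewrite setE Dpoly_places; case: infinity_free.
  rewrite mul1r -(Hseq_prod finite_places_uniq finite_places_prime).
  by congr (\sum_(h \in _) _); apply/seteqP; split=> h /= => [[]|].
rewrite -['X]expr1 convM Hseq_oo.
by apply: eq_conv => j _; rewrite (Hseq_prod finite_places_uniq finite_places_prime).
Qed.

End Places.

(** * Generating series of [bcoef] and [bhat] *)

Section CoefficientsB.
Variables (m : nat) (n : 'I_m -> nat).
Hypothesis n_gt0 : forall i, (0 < n i)%N.
Implicit Types S : {set 'I_m}.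
Local Notation sumn S := (\sum_(i in S) n i)%N.

Lemma Dpoly_sum : Dpoly n = \sum_(S : {set 'I_m}) (-1) ^+ #|S| *: 'X^(sumn S).
Proof.
rewrite /Dpoly; under eq_bigr => i _ do rewrite addrC.
rewrite bigA_distr; apply: eq_bigr => S _.
rewrite -(big_mkcond (fun i => i \in S)) /= prodrN prodrXr.
by rewrite -[in LHS](scale1r 1) -scaleNr exprZn expr1n -scalerAl mul1r.
Qed.

Lemma card_le_sumn S : (#|S| <= sumn S)%N.
Proof. by rewrite -sum1_card; apply: leq_sum => i _; apply: n_gt0. Qed.

Lemma conv_sum (I : Type) (s : seq I) (E : I -> {poly rat}) w j :
  conv (\sum_(i <- s) E i) w j = \sum_(i <- s) conv (E i) w j.
Proof.
apply: (big_morph (fun E => conv E w j)) => [E1 E2|]; first exact: convD.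
by rewrite /conv big1 // => i _; rewrite coef0 mul0r.
Qed.

(** The inclusion-exclusion formula is the expansion over subsets of [Dpoly] divided by 1 - q X. *)
Lemma bcoef_conv q j : (bcoef q n j)%:~R = conv (Dpoly n) (fun i => q%:R ^+ i) j :> rat.
Proof.
rewrite Dpoly_sum conv_sum.
under eq_bigr => S _ do rewrite convZ convXn.
transitivity (\sum_(S : {set 'I_m} | (sumn S <= j)%N)
  (-1) ^+ #|S| * q%:R ^+ (j - sumn S) : rat); last first.
  by rewrite [LHS]big_mkcond; apply: eq_bigr => S _; case: ifP; rewrite ?mulr0.
(* Every [n i] is at least 1, so the subsets of total degree at most [j] have at most [j] elements
   and [inord] does not alter their cardinality. *)
rewrite (partition_big (fun S : {set 'I_m} => inord #|S| : 'I_j.+1) xpredT) //= big_ord_recl.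
have condE (S : {set 'I_m}) (i : 'I_j.+1) : (sumn S <= j)%N && (inord #|S| == i) =
    (#|S| == i) && (sumn S <= j)%N.
  rewrite andbC; case: leqP => [le|]; rewrite ?andbF ?andbT //.
  by rewrite -val_eqE /= inordK // ltnS (leq_trans (card_le_sumn S)).
rewrite (eq_bigl (pred1 (finset.set0 : {set 'I_m}))); last first.
  move=> S; rewrite condE cards_eq0 /=; case: eqP => [->|] //=.
  by rewrite big_set0.
rewrite big_pred1_eq cards0 big_set0 subn0 expr0 mul1r.
rewrite /bcoef rmorphD rmorphXn /= big_add1 big_mkord rmorph_sum; congr (_ + _).
apply: eq_bigr => i _; rewrite rmorphM rmorphXn rmorphN1 rmorph_sum mulr_sumr /=.
rewrite [RHS](eq_bigl _ _ (fun S => condE S (lift ord0 i))).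
apply: eq_big => S; first by rewrite /= /bump.
by move=> /andP[/eqP-> _]; rewrite rmorphXn.
Qed.

Lemma conv_bhat q j :
  conv (1 - 'X) (fun i => (bhat q n i%:Z)%:~R : rat) j = (bcoef q n j)%:~R.
Proof.
rewrite -['X]expr1 conv_binomial1; case: j => [|j] /=.
  by rewrite big_nat1 subr0.
by rewrite subn1 /= [in X in X - _]big_nat_recr //= rmorphD addrC addKr.
Qed.

Lemma coef0_oneBX : (1 - 'X : {poly rat})`_0 = 1.
Proof. by rewrite coefB coef1 coefX subr0. Qed.

(** After multiplication by 1 - X, both sides become q - 1 times [Dpoly] divided by 1 - q X. *)
Lemma conv_Dpoly_Hseq (k : finFieldType) G :
  conv (Dpoly n) (@Hseq k [::]) G = (#|k|%:R - 1) * (bhat #|k| n G%:Z)%:~R.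
Proof.
pose u G := conv (Dpoly n) (@Hseq k [::]) G.
pose v G : rat := (#|k|%:R - 1) * (bhat #|k| n G%:Z)%:~R.
apply: (@conv_inj _ (1 - 'X) u v G coef0_oneBX) => // j _.
rewrite [RHS]conv_scale conv_bhat bcoef_conv -conv_scale -convM mulrC convM.
by apply: eq_conv => i _; rewrite conv_Hseq_nil.
Qed.

Hypothesis m_gt0 : (0 < m)%N.

Lemma Dpoly_size : (size (Dpoly n) <= (ntotal n).+1)%N.
Proof.
apply: (big_ind2 (fun (P : {poly rat}) d => (size P <= d.+1)%N)).
- by rewrite size_poly1.
- by move=> P1 d1 P2 d2; apply: size_mul_leS.
- by move=> i _; rewrite size_add_leq ?size_polyN ?size_polyXn ?size_poly1.
Qed.

Definition Cpoly : {poly rat} := Dpoly n %/ (1 - 'X).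

Lemma Cpoly_mul : (1 - 'X) * Cpoly = Dpoly n.
Proof.
rewrite mulrC; apply: divpK; rewrite /Dpoly (bigD1 (Ordinal m_gt0)) //=.
by apply: dvdp_mulr; rewrite -opprB -[1 - 'X^_]opprB dvdpNl dvdpNr subrX1 dvdp_mulr.
Qed.

Lemma ntotal_gt0 : (0 < ntotal n)%N.
Proof.
by rewrite /ntotal (bigD1 (Ordinal m_gt0)) //= addn_gt0 n_gt0.
Qed.

Lemma Cpoly_size : (size Cpoly <= ntotal n)%N.
Proof.
have sz1 : size (1 - 'X : {poly rat}) = 2.
  by rewrite -opprB size_polyN -['X - 1]/('X - 1%:P) size_XsubC.
rewrite -(prednK ntotal_gt0); apply: (size_mul_leS_cancel sz1).
by rewrite Cpoly_mul add1n (prednK ntotal_gt0) Dpoly_size.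
Qed.

(** The series of [bhat] is [Dpoly] divided by (1 - X)(1 - q X), so multiplying it by 1 - q X leaves
    [Cpoly]. *)
Lemma coef_Cpoly q j :
  Cpoly`_j = (bhat q n j%:Z - q%:Z * bhat q n (j%:Z - 1))%:~R.
Proof.
pose b i : rat := (bhat q n i%:Z)%:~R.
have -> : (bhat q n j%:Z - q%:Z * bhat q n (j%:Z - 1))%:~R = conv (1 - q%:R *: 'X) b j.
  rewrite -['X]expr1 conv_binomial /b rmorphB rmorphM /=; congr (_ - _ * _).
  by case: j => [|j] //=; rewrite subn1 /= -addn1 PoszD addrK.
rewrite -conv_delta.
apply: (@conv_inj _ (1 - 'X) (conv Cpoly _) (conv (1 - q%:R *: 'X) b) j coef0_oneBX) => // i _.
rewrite -!convM Cpoly_mul mulrC convM.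
transitivity (conv (1 - q%:R *: 'X) (conv (Dpoly n) (fun i => q%:R ^+ i)) i); last first.
  by apply: eq_conv => l _; rewrite conv_bhat bcoef_conv.
rewrite -convM mulrC convM; apply: eq_conv => l _.
by rewrite conv_geom.
Qed.

End CoefficientsB.
(** * Sums over all pairs *)

Section AllPairs.
Local Open Scope classical_set_scope.
Variables (k : finFieldType) (K : closedFieldType) (iota : {rmorphism k -> K}).
Hypothesis q_even : ~~ odd #|k|.
Local Notation q := #|k|.
Variables (m : nat) (n r : 'I_m -> nat).
Hypothesis n_gt0 : forall i, (0 < n i)%N.
Variable a : {ffun 'I_m -> option K}.
Hypothesis aA : Atuples k K n a.
Implicit Types (h f : {poly k}).
Local Notation weight := (weight iota n r a).
Local Notation poly_le := (@poly_le k).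

Definition nonzero_le (G : nat) : set {poly k} :=
  [set h : {poly k} | h != 0 /\ (size h <= G.+1)%N].

Lemma q_expf_neq0 e : q%:R ^+ e != 0 :> rat.
Proof. by rewrite expf_neq0 // pnatr_eq0 -lt0n ltnW // finNzRing_gt1. Qed.

Lemma Wseq_nil G : Wseq iota n r a [::] G = q%:R ^- G.+1 *
  \sum_(h \in nonzero_le G) \sum_(f \in poly_le (2 * G).+1) weight G (h, f).
Proof.
rewrite /Wseq /normalized (pair_fsbig _ (fun h f => weight G (h, f))).
- congr (_ * _); rewrite (_ : regular_pairs G [::] = nonzero_le G `*` poly_le (2 * G).+1).
    by apply: eq_fsbigr => -[].
  apply/seteqP; split=> -[h f] /=; first by case.
  by case=> -[h0 szh] szf; split.
- by apply: sub_finite_set (finite_poly_le k G.+1) => h [].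
- exact: finite_poly_le.
Qed.

Lemma weight_sqr G h f : (forall i, r i = 2) ->
  weight G (h, f) = (nonvanishing iota a G h)%:R.
Proof.
move=> r2; rewrite /weight /=.
have kP i d p : kext k K (n i) (evalP1 iota d p (a i)).
  exact/kext_evalP1/(Atuples_P1 aA).
under eq_bigr => i _ do rewrite r2 -rmorphXn (tau_sqr iota q_even (n_gt0 i)) //.
have [/forallP nv|] := boolP (nonvanishing iota a G h).
  by rewrite big1 // => i _; rewrite nv.
rewrite negb_forall => /existsP[i]; rewrite negbK => /eqP p0.
by rewrite (bigD1 i) //= p0 eqxx mul0r.
Qed.

(** The weight depends on [h] alone, so each admissible [h] counts once for each of the q^(2G+1)
    polynomials [f]. *)
Lemma Wseq_sqr G : (forall i, r i = 2) ->
  Wseq iota n r a [::] G = (q%:R - 1) * (q%:R ^+ G * (bhat q n G%:Z)%:~R).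
Proof.
move=> r2; rewrite Wseq_nil.
have -> : \sum_(h \in nonzero_le G) \sum_(f \in poly_le (2 * G).+1) weight G (h, f) =
    q%:R ^+ (2 * G).+1 * conv (Dpoly n) (@Hseq k [::]) G.
  rewrite -(count_nonvanishing iota n_gt0 aA) mulr_fsumr.
  transitivity (\sum_(h \in nonzero_le G `&` [set h : {poly k} | nonvanishing iota a G h])
      (q%:R ^+ (2 * G).+1 * 1 : rat)); last first.
    apply: eq_fsbigl; apply/seteqP; split=> h /=; first by case=> -[].
    by case.
  rewrite [RHS]fsbig_mkcondr; apply: eq_fsbigr => h _.
  under eq_fsbigr => f _ do rewrite weight_sqr //.
  have [nv|nv] := boolP (nonvanishing iota a G h).
    by rewrite mulr1 (fsum_const1 rat (finite_poly_le k _)) card_poly_le natrX mem_set.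
  by rewrite fsbig1 // memNset //; apply/negP.
rewrite conv_Dpoly_Hseq // (_ : (2 * G).+1 = G.+1 + G)%N; last by lia.
by rewrite exprD -!mulrA mulKf ?q_expf_neq0 // mulrCA.
Qed.

(** At a finite point, evaluation is injective on the q^(n i) polynomials of degree below [n i], and
    the target has as many elements. At infinity, [c] lies in [k] and is the value of a monomial. *)
Lemma place_surjective i e c : (n i <= e.+1)%N -> kext k K (n i) c ->
  exists2 v : {poly k}, (size v <= e.+1)%N & evalP1 iota e v (a i) = c.
Proof.
case ai : (a i) => [x|] lene kc; last first.
  have [c' c'E] : exists c', iota c' = c.
    by apply: frob_fixed; move: kc; rewrite (degree_infinity aA ai).
  exists (c' *: 'X^e); last by rewrite /= coefZ coefXn eqxx mulr1.
  by rewrite (leq_trans (size_scale_leq _ _)) // size_polyXn.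
pose phi (v : {poly k}) := (map_poly iota v).[x].
have [pp szp pP] := place_finite iota n_gt0 aA ai.
have kx : kext k K (n i) x by have := Atuples_P1 aA i; rewrite ai.
have inj_phi : {in poly_le (n i) &, injective phi}.
  move=> u v /set_mem szu /set_mem szv /eqP.
  rewrite -subr_eq0 /phi -hornerN -hornerD -rmorphB pP => puv.
  apply/eqP; rewrite -subr_eq0; apply/eqP/(small_dvdp _ puv).
  by rewrite szp ltnS size_add_leq ?size_polyN.
have finP := finite_poly_le k (n i).
have : fset_set (phi @` poly_le (n i)) = fset_set (kext k K (n i)).
  apply/eqP; rewrite eqEfcard; apply/andP; split.
    rewrite -fset_set_sub; [|exact: finite_image|exact: finite_kext].
    by move=> _ [v _ <-]; apply: kext_horner.
  rewrite card_kext // fset_set_image // card_in_imfset ?card_poly_le //.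
  by move=> u v /=; rewrite !in_fset_set // => *; apply: inj_phi.
move/fset_set_inj => /(_ (finite_image _ finP) (finite_kext iota (n_gt0 i))) imE.
have : (phi @` poly_le (n i)) c by rewrite imE.
case=> v szv <-; exists v => //; exact: leq_trans szv _.
Qed.

(** The two claims are proved together because evaluation is multiplicative only under the degree
    bounds. *)
Lemma evalP1_prod_place (P : pred 'I_m) x :
  (size (\prod_(i | P i) place iota n_gt0 aA i)%R <= (\sum_(i | P i) n i).+1)%N /\
  evalP1 iota (\sum_(i | P i) n i) (\prod_(i | P i) place iota n_gt0 aA i) x =
  \prod_(i | P i) evalP1 iota (n i) (place iota n_gt0 aA i) x.
Proof.
rewrite -!(big_filter _ P); elim: (filter P _) => [|i s [szs evs]].
  rewrite !big_nil size_poly1; split=> //.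
  by case: x => [x|] /=; rewrite ?rmorph1 ?hornerC // coef1 rmorph1.
rewrite !big_cons; split; first by rewrite size_mul_leS ?size_place.
by rewrite evalP1_mul ?size_place // evs.
Qed.

(** Take the product [M] of the other places times a cofactor [v] that adjusts the value at [a i];
    the bound on [ntotal n] leaves room for the [n i] coefficients of [v]. *)
Lemma separating_polynomial i G : (ntotal n <= (2 * G).+1)%N ->
  forall c, kext k K (n i) c -> exists f : {poly k},
  [/\ (size f <= (2 * G).+1)%N, evalP1 iota (2 * G) f (a i) = c &
      forall j, j != i -> evalP1 iota (2 * G) f (a j) = 0].
Proof.
rewrite /ntotal (bigD1 i) //=; set N := (\sum_(j | _) n j)%N => leG c kc.
pose M := \prod_(j | j != i) place iota n_gt0 aA j.
have [szM _] := evalP1_prod_place (fun j => j != i) None; rewrite -/N -/M in szM.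
have evM x : evalP1 iota N M x =
    \prod_(j | j != i) evalP1 iota (n j) (place iota n_gt0 aA j) x.
  by have [_] := evalP1_prod_place (fun j => j != i) x.
have Mi0 : evalP1 iota N M (a i) != 0.
  by rewrite evM; apply/prodf_neq0 => j ji; rewrite place_eval.
have Mj0 j : j != i -> evalP1 iota N M (a j) = 0.
  move=> ji; rewrite evM (bigD1 j) //=.
  have /eqP-> : evalP1 iota (n j) (place iota n_gt0 aA j) (a j) == 0 by rewrite place_eval.
  by rewrite mul0r.
have kM : kext k K (n i) (evalP1 iota N M (a i)) by apply/kext_evalP1/(Atuples_P1 aA).
have ni := n_gt0 i; have leN : (N <= 2 * G)%N by lia.
have [||v szv vE] := @place_surjective i (2 * G - N)%N (c / evalP1 iota N M (a i)).
- by lia.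
- by apply: kextM => //; apply: kextV.
exists (M * v); rewrite -[in (2 * G)%N](subnKC leN).
split; first exact: size_mul_leS.
  by rewrite evalP1_mul // vE mulrC divfK.
by move=> j ji; rewrite evalP1_mul // Mj0 // mul0r.
Qed.

Lemma Wseq_linear G i : r i = 1%N -> (ntotal n <= (2 * G).+1)%N ->
  Wseq iota n r a [::] G = 0.
Proof.
move=> ri leG; rewrite Wseq_nil fsbig1 ?mulr0 // => h _.
have /choice[F FP] c : exists f : {poly k}, kext k K (n i) c ->
    [/\ (size f <= (2 * G).+1)%N, evalP1 iota (2 * G) f (a i) = c &
      forall j, j != i -> evalP1 iota (2 * G) f (a j) = 0].
  have [kc|Nkc] := pselect (kext k K (n i) c); last by exists 0.
  by have [f fP] := separating_polynomial leG kc; exists f.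
have finkn := finite_kext iota (n_gt0 i); have finP := finite_poly_le k (2 * G).+1.
have kP j d p : kext k K (n j) (evalP1 iota d p (a j)).
  exact/kext_evalP1/(Atuples_P1 aA).
pose rest f : rat := \prod_(j | j != i) (tau k (n j) (evalP1 iota G h (a j))
  (evalP1 iota (2 * G) f (a j)))%:~R ^+ r j.
have weightE f c : kext k K (n i) c -> weight G (h, f + F c) =
    (tau k (n i) (evalP1 iota G h (a i)) (evalP1 iota (2 * G) f (a i) + c))%:~R * rest f.
  move=> /FP[_ Fi Fj]; rewrite /weight (bigD1 i) //= ri evalP1_add Fi; congr (_ * _).
  by apply: eq_bigr => j ji; rewrite evalP1_add Fj // addr0.
(* For fixed [f], adding [F c] moves only the value at [a i], which runs through the whole field as
   [c] does; [fsum_tau] applies. *)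
have sum0 : \sum_(c \in kext k K (n i)) \sum_(f \in poly_le (2 * G).+1)
    weight G (h, f + F c) = 0.
  rewrite exchange_fsbig //; apply: fsbig1 => f _.
  under eq_fsbigr => c /set_mem kc do rewrite weightE //.
  rewrite -mulr_fsuml; apply/eqP; rewrite mulf_eq0; apply/orP; left; apply/eqP.
  rewrite -[RHS](fsum_tau iota q_even (n_gt0 i) (kP i G h)); symmetry.
  apply: (reindex_fsbig (fun c => evalP1 iota (2 * G) f (a i) + c)).
  split=> [c kc|c1 c2 _ _ /addrI//|c kc]; first exact: kextD.
  exists (c - evalP1 iota (2 * G) f (a i)); last by rewrite addrC subrK.
  exact: kextB.
apply/eqP; move/eqP: sum0.
(* For fixed [c], f |-> f + F c permutes the polynomials, so the inner sum is the same for every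
   [c]; the double sum is a nonzero multiple of it. *)
rewrite (eq_fsbigr (fun=> 1 * \sum_(f \in poly_le (2 * G).+1) weight G (h, f))); last first.
  move=> c /set_mem kc; rewrite mul1r; have [szF _ _] := FP _ kc; symmetry.
  apply: (reindex_fsbig (fun f => f + F c)).
  split=> [f szf|f1 f2 _ _ /addIr//|f szf]; first exact: size_add_leq.
  by exists (f - F c); [rewrite /poly_le /= size_add_leq ?size_polyN | rewrite subrK].
rewrite -mulr_fsuml fsum_const1 // card_kext // mulf_eq0 natrX.
by rewrite (negbTE (q_expf_neq0 _)).
Qed.

End AllPairs.

(** * The recurrence for [ug] and the evaluation of its right side *)

Section LinearRecurrence.
Local Open Scope classical_set_scope.
Variables (k : finFieldType) (K : closedFieldType) (iota : {rmorphism k -> K}).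
Hypothesis q_even : ~~ odd #|k|.
Local Notation q := #|k|.
Variables (m : nat) (n r : 'I_m -> nat).
Hypotheses (n_gt0 : forall i, (0 < n i)%N) (r_gt0 : forall i, (0 < r i)%N).
Hypothesis m_gt0 : (0 < m)%N.

Definition Pseq (a : 'I_m -> option K) (G : nat) : rat :=
  normalized iota n r a G (@Pg k (G%:Z - 1)).

(** The smooth pairs arise from all pairs by sieving at every place; multiplying by [Cpoly]
    completes the sieving factors to the Euler product 1 - q X. *)
Lemma Pseq_recurrence (a : {ffun 'I_m -> option K}) G : Atuples k K n a ->
  \sum_(0 <= j < ntotal n | (j <= G)%N)
    (bhat q n j%:Z - q%:Z * bhat q n (j%:Z - 1))%:~R * Pseq a (G - j) =
  conv (1 - q%:R *: 'X) (Wseq iota n r a [::]) G.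
Proof.
move=> aA; have aP := Atuples_P1 aA.
(* Large enough for every prime that matters up to level [G] and for every place below [a]. *)
pose N := (G + ntotal n)%N; pose S := primes_upto k N.
have Sp : {in S, forall p, prime_poly p} by move=> p /primes_uptoP[].
have leN i : (n i <= N)%N.
  by rewrite /N /ntotal (bigD1 i) //= addnCA leq_addr.
have PseqE j : (j <= G)%N -> Pseq a j =
    conv ((1 - (nonvanishing iota a 1 1)%:R *: 'X) * Efactor iota a S)
      (Wseq iota n r a [::]) j.
  move=> lejG; rewrite convM -['X]expr1 /Pseq (@Pg_regular k _ j N) ?subrK //; last first.
    by rewrite (leq_trans lejG) ?leq_addr.
  rewrite (Wseq_oo iota q_even n_gt0 r_gt0 aP Sp).
  by apply: eq_conv => i _; rewrite (Wseq_prod iota q_even n_gt0 r_gt0 aP) ?primes_upto_uniq.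
transitivity (conv (Cpoly n) (Pseq a) G).
  rewrite /conv -(big_mkord xpredT (fun i => (Cpoly n)`_i * Pseq a (G - i))).
  rewrite [LHS](big_nat_widen _ _ (ntotal n + G.+1)) ?leq_addr //.
  rewrite [RHS](big_nat_widen _ _ (ntotal n + G.+1)) ?leq_addl //.
  rewrite [LHS]big_mkcond [RHS]big_mkcond; apply: eq_bigr => j _ /=; rewrite ltnS.
  case: (leqP j G) => //= lejG; rewrite -coef_Cpoly //; case: ltnP => // lenj.
  by rewrite nth_default ?mul0r // (leq_trans (Cpoly_size n_gt0 m_gt0)).
rewrite (eq_conv _ PseqE) -convM; apply: eq_convl => i leiG.
(* Up to degree [G], 1 - q X agrees with the truncated Euler product, and the resulting identity of
   polynomials is [Efactor_Dpoly] with 1 - X cancelled. *)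
rewrite -(@euler_product k N i) ?(leq_trans leiG) ?leq_addr //; congr ((polyseq _)`_i).
have X0 : (1 - 'X : {poly rat}) != 0.
  by apply/eqP => /(congr1 (fun p : {poly rat} => p`_0))/eqP; rewrite coef0_oneBX coef0 oner_eq0.
apply: (mulfI X0); rewrite !mulrA Cpoly_mul //.
exact: (Efactor_Dpoly iota n_gt0 aA leN).
Qed.

Lemma ug_Pseq (G : nat) : ug iota n r (G%:Z - 1) =
  \sum_(a \in Atuples k K n) Iconst k * Pseq a G.
Proof.
rewrite /ug; apply: eq_fsbigr => a _; rewrite /Ig /Pseq /normalized subrK absz_nat.
rewrite (_ : G%:Z - 1 + 2 = G.+1); last by lia.
by rewrite mulrAC mulrC.
Qed.

Lemma ug_recurrence (g : nat) :
  \sum_(0 <= j < ntotal n | j%:Z <= g%:Z + 1)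
    (bhat q n j%:Z - q%:Z * bhat q n (j%:Z - 1))%:~R * ug iota n r (g%:Z - j%:Z) =
  \sum_(a \in Atuples k K n)
    Iconst k * (Wseq iota n r a [::] g.+1 - q%:R * Wseq iota n r a [::] g).
Proof.
have finA := finite_Atuples iota n_gt0.
rewrite fsbig_finite //.
transitivity (\sum_(0 <= j < ntotal n | (j <= g.+1)%N) \sum_(a <- fset_set (Atuples k K n))
   Iconst k * ((bhat q n j%:Z - q%:Z * bhat q n (j%:Z - 1))%:~R * Pseq a (g.+1 - j))).
  apply: eq_big => [j|j lej]; first by lia.
  rewrite (_ : g%:Z - j%:Z = (g.+1 - j)%N%:Z - 1); last by lia.
  rewrite ug_Pseq fsbig_finite // mulr_sumr; apply: eq_bigr => a _.
  by rewrite mulrCA.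
rewrite exchange_big /=; apply: eq_big_seq => a; rewrite in_fset_set // => /set_mem aA.
by rewrite -mulr_sumr Pseq_recurrence // -['X]expr1 conv_binomial subn1.
Qed.

End LinearRecurrence.

Theorem theorem9p12
    (k : finFieldType) (K : closedFieldType) (iota : {rmorphism k -> K})
    (Kalg : integralRange iota) (q_even : ~~ odd #|k|)
    (m : nat) (m_ge1 : (1 <= m)%N) (n r : 'I_m -> nat) (nrN : inN n r)
    (g : int) :
  let q := #|k| in
  let b := bhat q n in
  let lhs := \sum_(0 <= j < ntotal n | j%:Z <= g + 1)
    (b j%:Z - q%:Z * b (j%:Z - 1))%:~R * ug iota n r (g - j%:Z) in
  ((forall i, r i = 2%N) -> 0 <= g ->
     lhs = Jconst k K n * q%:R ^ (g + 1) * (b (g + 1) - b g)%:~R) /\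
  ((exists i, r i = 1%N) -> ((ntotal n)%:R - 1) / 2 <= g%:~R :> rat ->
     lhs = 0).
Proof.
move: nrN => [n_gt0 r12] q b lhs.
have r_gt0 i : (0 < r i)%N by case: (r12 i) => ->.
have lhsE (g' : nat) : g = g'%:Z -> lhs = \sum_(a \in Atuples k K n)
    Iconst k * (Wseq iota n r a [::] g'.+1 - q%:R * Wseq iota n r a [::] g').
  by move=> gE; rewrite -ug_recurrence // /lhs gE.
have finA := finite_Atuples iota n_gt0.
split=> [r2|[i ri]].
  case: g @lhs lhsE => // g' lhs /(_ g' erefl) -> _.
  (* Every tuple contributes the same amount, so the sum becomes the number of tuples, a factor of
     [Jconst], times it. *)
  rewrite (eq_fsbigr (fun=> 1 * (Iconst k * ((q%:R - 1) * q%:R ^+ g'.+1 *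
    (b g'.+1%:Z - b g'%:Z)%:~R)))); last first.
    move=> a /set_mem aA; rewrite !Wseq_sqr // mul1r; congr (_ * _).
    by rewrite rmorphB /= exprS; ring.
  rewrite -mulr_fsuml fsum_const1 // /Jconst -/q.
  rewrite (_ : g'%:Z + 1 = g'.+1); last by lia.
  by rewrite -exprnP; ring.
move=> le_g; have lt_ng : (ntotal n)%:Z <= 2 * g + 1.
  by rewrite -(ler_int rat) rmorphD rmorphM /= mulrC -lerBlDr -ler_pdivrMr.
have n_pos := ntotal_gt0 n_gt0 m_ge1.
(* Since [ntotal n] is at least 1, the bound forces [g] to be nonnegative. *)
have gE : g = `|g|%N%:Z by lia.
rewrite (lhsE _ gE); apply: fsbig1 => a aA.
(* Both levels g + 1 and g must vanish; the lower one requires exactly that [ntotal n] be at most 2g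
   + 1. *)
rewrite !(Wseq_linear iota q_even n_gt0 aA ri) ?mulr0 ?subr0 ?mulr0 //; lia.
Qed.
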